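(* Let $H(x,y,t)$ be a smooth non-autonomous Hamiltonian, with respect to the 2-form $dx\wedge dy$, with $2\pi$-periodic dependence in $t$. Adding $E$ as a conjugate variable of $t$, consider the autonomous Hamiltonian $\mathcal{H}(x,t,y,E)=H(x,y,t)+E$ with respect to the 2-form $dx\wedge dy+dt\wedge dE$. Denote its solutions, with new time $\tau$ and initial condition $(x_0,t_0,y_0,E_0)$ at $\tau=0$, by $$(x^{\tau},t^{\tau},y^{\tau},E^{\tau})(x_0,t_0,y_0,E_0),\qquad t^{\tau}(x_0,t_0,y_0,E_0)=t_0+\tau.$$ Consider the section $\Xi=\{x=0\}\cap\{\mathcal{H}=0\}$, and suppose that the equation $\mathcal{H}(0,t,y,E)=0$ allows writing, at least locally for $(t,E)\in U\subset\mathbb{R}^2$, the variable $y$ as $y=y(t,E)$, with $y(t,E)$ a smooth function with $2\pi$-periodic dependence in $t$. Suppose also that one can define an impact time $\tilde\tau(t_0,E_0)>0$ for which $$x^{\tilde\tau(t_0,E_0)}(0,t_0,y(t_0,E_0),E_0)=0\qquad\text{for any }(t_0,E_0)\in U,$$ with $\tilde\tau$ a smooth function with $2\pi$-periodic dependence in $t_0$. Define the map $F:U\to\mathbb{R}^2$ by $$F(t_0,E_0)=(t_1,E_1)=(t_0+f_{t_0}(t_0,E_0),\,f_{E_0}(t_0,E_0)),$$ where $f_{t_0}(t_0,E_0)=\tilde\tau(t_0,E_0)$ and $$f_{E_0}(t_0,E_0)=E^{\tilde\tau(t_0,E_0)}(0,t_0,y(t_0,E_0),E_0)=-H\big(0,\,y^{\tilde\tau(t_0,E_0)}(0,t_0,y(t_0,E_0),E_0),\,t_0+\tilde\tau(t_0,E_0)\big).$$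 (Thus the solution with initial condition $(0,t_0,y(t_0,E_0),E_0)\in\Xi$ integrated up to time $\tilde\tau(t_0,E_0)$ is the point $(0,t_1,y_1,E_1)\in\Xi$, with $y_1=y^{\tilde\tau(t_0,E_0)}(0,t_0,y(t_0,E_0),E_0)$.) Then $F$ is exact symplectic with respect to the 1-form $E_0\,dt_0$, i.e. there is a function $S(t_0,E_0)$, $2\pi$-periodic in $t_0$, such that $$F^{*}(E_1\,dt_1)=E_0\,dt_0+dS(t_0,E_0).$$
   Context: Hamilton's equations for $\mathcal{H}$ (derivative with respect to $\tau$ denoted by $'$) are $x'=\partial_y H$, $t'=1$, $y'=-\partial_x H$, $E'=-\partial_t H$. The set $U\subset\mathbb{R}^2$ is open and invariant under $(t,E)\mapsto(t+2\pi,E)$, so that $2\pi$-periodicity in $t$ of functions on $U$ makes sense; the solutions involved are assumed to exist up to time $\tilde\tau$. *)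

(* Defs.v *)
From Stdlib Require Import Reals.
From Coquelicot Require Import Coquelicot.
Open Scope R_scope.

(* [C_on k A f]: [f] is of class C^k on [A]; meant for [A] open and [V]
   finite-dimensional.  The derivatives of [f] are its directional ones. *)
Fixpoint C_on {V : NormedModule R_AbsRing} (k : nat) (A : V -> Prop)
    (f : V -> R) : Prop :=
  match k with
  | O => forall p, A p -> continuous f p
  | S k' =>
      (forall p, A p -> ex_filterdiff f (locally p)) /\
      (forall v, C_on k' A (fun p => Derive (fun s => f (plus p (scal s v))) 0))
  end.

Definition smooth_on {V : NormedModule R_AbsRing} (A : V -> Prop)
    (f : V -> R) : Prop :=
  forall k, C_on k A f.

(* Arguments of H are ordered (x, y, t). *)
Definition config : Type := (R * R * R)%type.

(* Points of the extended phase space are ordered (x, t, y, E); the symplectic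
   form is dx /\ dy + dt /\ dE. *)
Definition phase : Type := (R * R * R * R)%type.

Definition x_of (z : phase) : R := let '(x, t, y, E) := z in x.
Definition t_of (z : phase) : R := let '(x, t, y, E) := z in t.
Definition y_of (z : phase) : R := let '(x, t, y, E) := z in y.
Definition E_of (z : phase) : R := let '(x, t, y, E) := z in E.

Definition extended_hamiltonian (H : config -> R) (z : phase) : R :=
  let '(x, t, y, E) := z in H (x, y, t) + E.

Definition hamilton_field (H : config -> R) (z : phase) : phase :=
  let '(x, t, y, E) := z in
  (Derive (fun s => H (x, s, t)) y,
   1,
   - Derive (fun s => H (s, y, t)) x,
   - Derive (fun s => H (x, y, s)) t).

(* The derivative is two-sided also at the end points, as for a flow, whose
   solutions are defined on open time intervals. *)
Definition solves_hamilton (D : config -> Prop) (H : config -> R)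
    (z0 : phase) (T : R) (gamma : R -> phase) : Prop :=
  gamma 0 = z0 /\
  forall tau, 0 <= tau <= T ->
    D (x_of (gamma tau), y_of (gamma tau), t_of (gamma tau)) /\
    is_derive (gamma : R -> R * R * R * R) tau (hamilton_field H (gamma tau)).

Definition section (H : config -> R) (z : phase) : Prop :=
  x_of z = 0 /\ extended_hamiltonian H z = 0.

Definition section_point (y : R * R -> R) (p : R * R) : phase :=
  (0, fst p, y p, snd p).

Definition impact_map (phi : R -> phase -> phase) (y ttau : R * R -> R)
    (p : R * R) : R * R :=
  (fst p + ttau p, E_of (phi (ttau p) (section_point y p))).

(* A 1-form on R^2, as a map from points to covectors. *)
Definition form1 : Type := R * R -> R * R -> R.

(* E dt in the coordinates (t, E). *)
Definition E_dt : form1 := fun p v => snd p * fst v.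

(* F^* alpha = alpha + dS on U, with (F^* alpha)_p (v) = alpha_(F p) (dF_p v),
   and S is 2 pi-periodic in its first argument. *)
Definition exact_symplectic (alpha : form1) (U : R * R -> Prop)
    (F : R * R -> R * R) : Prop :=
  exists S : R * R -> R,
    (forall t E, U (t, E) -> S (t + 2 * PI, E) = S (t, E)) /\
    forall p, U p ->
      exists (dF : R * R -> R * R) (dS : R * R -> R),
        filterdiff F (locally p) dF /\
        filterdiff S (locally p) dS /\
        forall v, alpha (F p) (dF v) = alpha p v + dS v.

(* Main.v *)
Require Import Defs.
From Stdlib Require Import Reals Lra Lia Psatz List Classical.
From Stdlib Require Import IndefiniteDescription.
From Coquelicot Require Import Coquelicot.
Open Scope R_scope.

(* The generating function is the action: with [w q s], [0 <= s <= 1], the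
   trajectory from the section point of [q], time being rescaled by [ttau q],
   [S q] is the integral of [y dx + E dt] along [w q].  On the level
   [H + E = 0] the first variation of the action reduces to its boundary terms;
   since [x = 0] at both ends, these are [E1 dt1 - E0 dt0], whence [dS].
   Periodicity of [S] is uniqueness of solutions.  The rescaling puts all
   trajectories on the same time interval, so that no trajectory has to be
   extended beyond its impact time.  Differentiability of the flow with respect
   to the initial point comes from Gronwall estimates alone. *)

(** * Linear identities in normed modules *)

(** The hypotheses say only that [phi] solves Hamilton's equations from section points up to the
    impact time; how it depends on the initial point is not given, so even the differentiability of
    the impact map must be proved. The two halves of the claim need different strength. For dS a
    Lipschitz dependence on [q] is enough: once the boundary term is removed, what remains of the
    integrand is negligible to first order in the deviation of the trajectory, and at the ends,
    where x = 0, the boundary term involves only the explicit times [fst q] and [fst q + ttau q]. A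
    true derivative of the flow is needed only for the component E1 of the map, and it is extracted
    from approximate linear relations between increments. Since [H] lives on an open set [D] and no
    global Lipschitz bound is available, every estimate is made in a thin tube around the one
    compact trajectory starting from [p]; [C1_along] records what is needed of the field there. The
    ODE estimates are stated in abstract normed modules, hence the small reflection procedure for
    vector identities that comes next. *)

Inductive mexpr : Type :=
| MVar (n : nat)
| MZero
| MPlus (a b : mexpr)
| MOpp (a : mexpr)
| MScal (k : R) (a : mexpr).

Fixpoint meval {V : NormedModule R_AbsRing} (l : list V) (e : mexpr) : V :=
  match e with
  | MVar n => nth n l zero
  | MZero => zero
  | MPlus a b => plus (meval l a) (meval l b)
  | MOpp a => opp (meval l a)
  | MScal k a => scal k (meval l a)
  end.

Fixpoint mcoef (e : mexpr) (n : nat) : R :=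
  match e with
  | MVar m => if Nat.eqb m n then 1 else 0
  | MZero => 0
  | MPlus a b => mcoef a n + mcoef b n
  | MOpp a => - mcoef a n
  | MScal k a => k * mcoef a n
  end.

(** Coefficients are indexed by all of [nat]; those beyond the length of the list are ignored, in
    agreement with the default [zero] of [nth] in [meval]. *)
Fixpoint mcomb {V : NormedModule R_AbsRing} (l : list V) (c : nat -> R) : V :=
  match l with
  | nil => zero
  | cons v l' => plus (scal (c O) v) (mcomb l' (fun n => c (S n)))
  end.

Section Mcomb.
Context {V : NormedModule R_AbsRing}.

Lemma mcomb_ext (l : list V) (c d : nat -> R) :
  (forall n, c n = d n) -> mcomb l c = mcomb l d.
Proof.
  revert c d; induction l as [|v l IH]; intros c d Hcd; simpl; auto.
  rewrite (Hcd O), (IH _ (fun n => d (S n))); auto.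
Qed.

Lemma mcomb_zero (l : list V) : mcomb l (fun _ => 0) = zero.
Proof.
  induction l as [|v l IH]; simpl; auto.
  rewrite IH, plus_zero_r; apply (scal_zero_l v).
Qed.

Lemma mcomb_plus (l : list V) (c d : nat -> R) :
  mcomb l (fun n => c n + d n) = plus (mcomb l c) (mcomb l d).
Proof.
  revert c d; induction l as [|v l IH]; intros c d; simpl.
  - now rewrite plus_zero_r.
  - rewrite IH, (scal_distr_r (c O) (d O) v : scal (c O + d O) v = _).
    rewrite <- !plus_assoc; f_equal; rewrite !plus_assoc; f_equal.
    apply plus_comm.
Qed.

Lemma mcomb_scal (l : list V) (k : R) (c : nat -> R) :
  mcomb l (fun n => k * c n) = scal k (mcomb l c).
Proof.
  revert c; induction l as [|v l IH]; intros c; simpl.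
  - symmetry; apply (scal_zero_r (V := V) k).
  - rewrite IH, scal_distr_l; f_equal.
    symmetry; apply (scal_assoc k (c O) v).
Qed.

Lemma meval_mcomb (l : list V) (e : mexpr) : meval l e = mcomb l (mcoef e).
Proof.
  induction e as [n| |a IHa b IHb|a IHa|k a IHa]; simpl.
  - revert n; induction l as [|v l IH]; intros n; simpl.
    + now destruct n.
    + destruct n as [|n]; simpl.
      * rewrite mcomb_zero, plus_zero_r; symmetry; apply (scal_one v).
      * rewrite (IH n), (scal_zero_l v : scal 0 v = zero), plus_zero_l.
        reflexivity.
  - now rewrite mcomb_zero.
  - now rewrite IHa, IHb, mcomb_plus.
  - rewrite IHa.
    transitivity (mcomb l (fun n => -1 * mcoef a n)).
    + rewrite mcomb_scal; symmetry; apply (scal_opp_one (mcomb l (mcoef a))).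
    + apply mcomb_ext; intros n; ring.
  - now rewrite IHa, mcomb_scal.
Qed.

Lemma meval_eq (l : list V) (a b : mexpr) :
  mcomb l (mcoef a) = mcomb l (mcoef b) -> meval l a = meval l b.
Proof. now rewrite !meval_mcomb. Qed.

End Mcomb.

Ltac matom x l :=
  lazymatch l with
  | cons x _ => constr:(O)
  | cons _ ?l' => let n := matom x l' in constr:(S n)
  end.
Ltac madd x l :=
  lazymatch l with
  | context [cons x _] => l
  | _ => constr:(cons x l)
  end.
Ltac matoms e l :=
  lazymatch e with
  | plus ?a ?b => let l' := matoms a l in matoms b l'
  | minus ?a ?b => let l' := matoms a l in matoms b l'
  | opp ?a => matoms a l
  | scal ?k ?a => matoms a l
  | zero => l
  | _ => madd e l
  end.
Ltac mreify e l :=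
  lazymatch e with
  | plus ?a ?b =>
      let a' := mreify a l in let b' := mreify b l in constr:(MPlus a' b')
  | minus ?a ?b =>
      let a' := mreify a l in let b' := mreify b l in
      constr:(MPlus a' (MOpp b'))
  | opp ?a => let a' := mreify a l in constr:(MOpp a')
  | scal ?k ?a => let a' := mreify a l in constr:(MScal k a')
  | zero => constr:(MZero)
  | _ => let n := matom e l in constr:(MVar n)
  end.
(* Proves linear identities between vectors of [V] by reflection: the
   coefficients of each atomic vector are compared by [ring]. *)
Tactic Notation "module_ring" constr(V) :=
  lazymatch goal with
  | |- @eq _ ?a ?b =>
      let l0 := constr:(@nil (NormedModule.sort R_AbsRing V)) in
      let l1 := matoms a l0 in
      let l := matoms b l1 in
      let a' := mreify a l in
      let b' := mreify b l in
      change (meval l a' = meval l b');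
      apply meval_eq; simpl;
      repeat match goal with
      | |- plus (scal ?k ?u) ?r = plus (scal ?k' ?u) ?r' =>
          refine (f_equal2 plus (f_equal (fun c => scal c u) _) _)
      end;
      unfold scal, opp, plus, minus, one, zero; simpl; unfold mult; simpl;
      first [reflexivity | ring]
  end.

Section Norm.
Context {V : NormedModule R_AbsRing}.

Lemma norm_plus_le (x y : V) : norm (plus x y) <= norm x + norm y.
Proof. apply (norm_triangle x y). Qed.

Lemma norm_minus_le (x y : V) : norm (minus x y) <= norm x + norm y.
Proof.
  unfold minus; rewrite <- (norm_opp y); apply norm_triangle.
Qed.

Lemma norm_minus_self (x : V) : norm (minus x x) = 0.
Proof. rewrite minus_eq_zero; apply (@norm_zero _ V). Qed.

Lemma norm_scal_le (k : R) (x : V) : norm (scal k x) <= Rabs k * norm x.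
Proof. apply (norm_scal k x). Qed.

End Norm.


(** * A comparison principle for norms *)

(** Neighbourhoods are defined by the balls of the uniform structure, which match norm balls only up
    to a factor. This and the next lemmas move everything to the norm, where the estimates are
    done. *)
Lemma locally_norm_iff {V : NormedModule R_AbsRing} (P : V -> Prop) (x : V) :
  locally x P <->
  exists d, 0 < d /\ forall y, norm (minus y x) < d -> P y.
Proof.
  split.
  - intros HP; destruct (locally_norm_le_locally x P HP) as [d Hd].
    exists d; split; [apply cond_pos | exact Hd].
  - intros [d [Hd HP]]; apply (locally_le_locally_norm x P).
    now exists (mkposreal d Hd).
Qed.

Lemma continuous_norm_iff {U V : NormedModule R_AbsRing} (f : U -> V) (x : U) :
  continuous f x <->
  forall e, 0 < e -> exists d, 0 < d /\
    forall y, norm (minus y x) < d -> norm (minus (f y) (f x)) < e.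
Proof.
  split.
  - intros Hf e He.
    apply (locally_norm_iff (fun y => norm (minus (f y) (f x)) < e) x).
    apply (Hf (fun z => norm (minus z (f x)) < e)).
    apply locally_norm_iff; exists e; auto.
  - intros Hf P HP; apply locally_norm_iff in HP; destruct HP as [e [He HP]].
    destruct (Hf e He) as [d [Hd Hfd]].
    apply (locally_norm_iff (fun y => P (f y)) x); exists d; auto.
Qed.

Lemma filterdiff_norm_iff {U V : NormedModule R_AbsRing}
    (f : U -> V) (x : U) (l : U -> V) :
  filterdiff f (locally x) l <->
  is_linear l /\
  forall e, 0 < e -> exists d, 0 < d /\
    forall y, norm (minus y x) < d ->
      norm (minus (minus (f y) (f x)) (l (minus y x))) <= e * norm (minus y x).
Proof.
  split.
  - intros [Hl Hf]; split; auto; intros e He.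
    apply (locally_norm_iff (fun y =>
      norm (minus (minus (f y) (f x)) (l (minus y x))) <=
        e * norm (minus y x)) x).
    apply (Hf x (fun P HP => HP) (mkposreal e He)).
  - intros [Hl Hf]; split; auto; intros x' Hx' e.
    rewrite <- (is_filter_lim_locally_unique _ _ Hx').
    apply (locally_norm_iff (fun y =>
      norm (minus (minus (f y) (f x)) (l (minus y x))) <=
        e * norm (minus y x)) x).
    apply Hf, cond_pos.
Qed.

Lemma is_derive_norm {V : NormedModule R_AbsRing} (f : R -> V) (s : R) (l : V) :
  is_derive f s l ->
  forall e, 0 < e -> exists d, 0 < d /\
    forall u, Rabs (u - s) < d ->
      norm (minus (minus (f u) (f s)) (scal (u - s) l)) <= e * Rabs (u - s).
Proof.
  intros Hf.
  exact (proj2 (proj1 (filterdiff_norm_iff f s (fun y => scal y l)) Hf)).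
Qed.

(** At a first contact the barrier would be rising strictly faster than [norm f] can, so just before
    it [norm f] would already lie above. Only the norm of [f'] is used: the norm itself need not be
    differentiable. Since slopes are compared only at contact points, a bound on [f'] that is valid
    merely below the barrier is enough. *)
Lemma norm_barrier {V : NormedModule R_AbsRing} (f f' : R -> V) (B B' : R -> R) :
  (forall s, 0 <= s <= 1 -> is_derive f s (f' s)) ->
  (forall s, 0 <= s <= 1 -> is_derive B s (B' s)) ->
  norm (f 0) < B 0 ->
  (forall s, 0 <= s <= 1 -> norm (f s) = B s -> norm (f' s) < B' s) ->
  forall s, 0 <= s <= 1 -> norm (f s) < B s.
Proof.
  intros Hf HB H0 Hcross s1 Hs1.
  apply Rnot_le_lt; intros Hbad.
  assert (Hcont : forall s, 0 <= s <= 1 -> forall e, 0 < e ->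
    exists d, 0 < d /\ forall u, Rabs (u - s) < d ->
      Rabs ((B u - norm (f u)) - (B s - norm (f s))) < e).
  { intros s Hs e He.
    destruct (proj1 (continuous_norm_iff f s)
      (ex_derive_continuous f s (ex_intro _ _ (Hf s Hs))) (e / 2))
      as [d1 [Hd1 H1]]; [lra|].
    destruct (proj1 (continuous_norm_iff B s)
      (ex_derive_continuous B s (ex_intro _ _ (HB s Hs))) (e / 2))
      as [d2 [Hd2 H2]]; [lra|].
    exists (Rmin d1 d2); split; [now apply Rmin_glb_lt|].
    intros u Hu.
    assert (N1 := H1 u (Rlt_le_trans _ _ _ Hu (Rmin_l _ _))).
    assert (N2 : Rabs (B u - B s) < e / 2)
      by exact (H2 u (Rlt_le_trans _ _ _ Hu (Rmin_r _ _))).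
    assert (N3 := norm_triangle_inv (f u) (f s)).
    replace (B u - norm (f u) - (B s - norm (f s)))
      with ((B u - B s) + - (norm (f u) - norm (f s))) by ring.
    eapply Rle_lt_trans; [apply Rabs_triang|]; rewrite Rabs_Ropp; lra. }
  (* The supremum [s0] of the times up to which the strict bound holds. Below the barrier at [s0]
     the bound extends further; above it, continuity contradicts the bound on the left; contact is
     excluded by the slopes. *)
  set (Ex := fun s => 0 <= s <= s1 /\
    forall u, 0 <= u <= s -> norm (f u) < B u).
  destruct (completeness Ex) as [s0 [Hub Hlub]].
  { exists s1; intros s [Hs _]; lra. }
  { exists 0; split; [lra|]; intros u Hu; now replace u with 0 by lra. }
  assert (Hs0 : 0 <= s0 <= s1).
  { split.
    - apply Hub; split; [lra|]; intros u Hu; now replace u with 0 by lra.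
    - apply Hlub; intros s [Hs _]; lra. }
  assert (Hbelow : forall u, 0 <= u < s0 -> norm (f u) < B u).
  { intros u Hu; apply Rnot_le_lt; intros Hu'.
    assert (s0 <= u); [|lra].
    apply Hlub; intros s [Hs Hs']; apply Rnot_lt_le; intros Hus.
    specialize (Hs' u); lra. }
  destruct (Rtotal_order (norm (f s0)) (B s0)) as [Hlt|[Heq|Hgt]].
  - destruct (Hcont s0 ltac:(lra) (B s0 - norm (f s0))) as [d [Hd Hnear]];
      [lra|].
    assert (Hin : forall u, 0 <= u < s0 + d -> norm (f u) < B u).
    { intros u Hu; destruct (Rlt_le_dec u s0) as [Hus|Hus];
        [apply Hbelow; lra|].
      assert (Hn := Hnear u ltac:(apply Rabs_def1; lra)).
      apply Rabs_def2 in Hn; lra. }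
    destruct (Rlt_le_dec s1 (s0 + d)) as [Hsd|Hsd].
    + specialize (Hin s1); lra.
    + assert (s0 + d / 2 <= s0); [|lra].
      apply Hub; split; [lra|]; intros u Hu; apply Hin; lra.
  - assert (Hpos : 0 < s0).
    { destruct (Req_dec s0 0) as [->|]; [|lra]; lra. }
    assert (Hs01 : 0 <= s0 <= 1) by lra.
    assert (Hslope := Hcross s0 Hs01 Heq).
    (* The first-order errors of [f] and [B] over the step [h] total [2 * e * h], half of the gap
       between the slopes. *)
    set (e := (B' s0 - norm (f' s0)) / 4).
    destruct (is_derive_norm f s0 _ (Hf s0 Hs01) e) as [d1 [Hd1 H1]];
      [unfold e; lra|].
    destruct (is_derive_norm B s0 _ (HB s0 Hs01) e) as [d2 [Hd2 H2]];
      [unfold e; lra|].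
    set (h := Rmin (s0 / 2) (Rmin (d1 / 2) (d2 / 2))).
    assert (Hh : 0 < h /\ h <= s0 / 2 /\ h <= d1 / 2 /\ h <= d2 / 2).
    { unfold h; repeat split.
      - repeat apply Rmin_glb_lt; lra.
      - apply Rmin_l.
      - eapply Rle_trans; [apply Rmin_r | apply Rmin_l].
      - eapply Rle_trans; [apply Rmin_r | apply Rmin_r]. }
    assert (Hab : Rabs (s0 - h - s0) = h).
    { replace (s0 - h - s0) with (- h) by ring.
      rewrite Rabs_Ropp; apply Rabs_pos_eq; lra. }
    specialize (H1 (s0 - h)); specialize (H2 (s0 - h)).
    rewrite Hab in H1, H2; specialize (H1 ltac:(lra)); specialize (H2 ltac:(lra)).
    change (Rabs (B (s0 - h) - B s0 - (s0 - h - s0) * B' s0) <= e * h) in H2.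
    assert (Hb := Hbelow (s0 - h) ltac:(lra)).
    assert (Hfs : norm (f s0) <= norm (f (s0 - h)) + e * h + h * norm (f' s0)).
    { replace (f s0) with (minus (minus (f (s0 - h))
        (minus (minus (f (s0 - h)) (f s0)) (scal (s0 - h - s0) (f' s0))))
        (scal (s0 - h - s0) (f' s0))) by module_ring V.
      eapply Rle_trans; [apply norm_minus_le|].
      apply Rplus_le_compat.
      - eapply Rle_trans; [apply norm_minus_le|]; lra.
      - eapply Rle_trans; [apply norm_scal_le|]; rewrite Hab; lra. }
    apply Rabs_le_between in H2.
    assert (He : 4 * e = B' s0 - norm (f' s0)) by (unfold e; field).
    nra.
  - destruct (Hcont s0 ltac:(lra) (norm (f s0) - B s0)) as [d [Hd Hnear]];
      [lra|].
    assert (Hpos : 0 < s0).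
    { destruct (Req_dec s0 0) as [->|]; [|lra]; lra. }
    set (u := Rmax 0 (s0 - d / 2)).
    assert (Hu : 0 <= u < s0 /\ s0 - d / 2 <= u).
    { unfold u; repeat split; [apply Rmax_l | apply Rmax_lub_lt; lra |
        apply Rmax_r]. }
    assert (Hn := Hnear u ltac:(apply Rabs_def1; lra)).
    apply Rabs_def2 in Hn; specialize (Hbelow u); lra.
Qed.

(** * Dependence of flows on parameters *)

(** Compactness of [0, 1]: finitely many local radii cover the interval, and monotonicity allows
    replacing them by the smallest. *)
Lemma unit_interval_uniform (Q : R -> R -> Prop) :
  (forall s d d', Q s d -> 0 < d' <= d -> Q s d') ->
  (forall s0, 0 <= s0 <= 1 -> exists d, 0 < d /\
     forall s, 0 <= s <= 1 -> Rabs (s - s0) < d -> Q s d) ->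
  exists d, 0 < d /\ forall s, 0 <= s <= 1 -> Q s d.
Proof.
  intros Hmono Hloc.
  destruct (functional_choice (fun s0 (d : posreal) => 0 <= s0 <= 1 ->
    forall s, 0 <= s <= 1 -> Rabs (s - s0) < d -> Q s d)) as [delta Hdelta].
  { intros s0; destruct (classic (0 <= s0 <= 1)) as [Hs0|Hs0].
    - destruct (Hloc s0 Hs0) as [d [Hd HQ]].
      now exists (mkposreal d Hd).
    - exists (mkposreal 1 Rlt_0_1); intros; contradiction. }
  destruct (compactness_value_1d 0 1 delta) as [d Hd].
  exists d; split; [apply cond_pos|]; intros s Hs.
  (* [compactness_value_1d] yields the covering point only under a double negation. *)
  apply NNPP; intros HnQ; apply (Hd s Hs); intros [t [Ht [Hst Hdt]]].
  apply HnQ, (Hmono s (delta t)); [now apply Hdelta|].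
  split; [apply cond_pos | exact Hdt].
Qed.

(** First-order expansion of [X] at the points of the curve, with derivative [A s] and with a radius
    independent of [s]. One constant [M] bounds both values and derivatives. The base points stay on
    the curve, so nothing is asked of the derivative elsewhere. *)
Definition C1_along {V W : NormedModule R_AbsRing} (X : V -> W) (w : R -> V)
    (A : R -> V -> W) (M : R) : Prop :=
  (forall s, 0 <= s <= 1 ->
     is_linear (A s) /\ norm (X (w s)) <= M /\
     forall v, norm (A s v) <= M * norm v) /\
  (forall e, 0 < e -> exists d, 0 < d /\
     forall s z, 0 <= s <= 1 -> norm (minus z (w s)) < d ->
       norm (minus (minus (X z) (X (w s))) (A s (minus z (w s)))) <=
         e * norm (minus z (w s))).

Definition solves_on_unit {V : NormedModule R_AbsRing} (X : V -> V) (mu : R)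
    (w : R -> V) : Prop :=
  forall s, 0 <= s <= 1 -> is_derive w s (scal mu (X (w s))).

Lemma is_derive_exp_scaled (c L s : R) :
  is_derive (fun s => c * exp (L * s)) s (c * L * exp (L * s)).
Proof. auto_derive; auto; ring. Qed.

Lemma exp_scaled_bounds (L s : R) :
  0 <= L -> 0 <= s <= 1 -> 1 <= exp (L * s) <= exp L.
Proof.
  intros HL Hs; assert (Hexp : forall x y, x <= y -> exp x <= exp y).
  { intros x y [Hxy | ->]; [left; now apply exp_increasing | right; auto]. }
  split; [rewrite <- exp_0|]; apply Hexp; nra.
Qed.

Section C1Along.
Context {V W : NormedModule R_AbsRing}.
Variables (X : V -> W) (w0 : R -> V) (A : R -> V -> W) (M : R).
Hypothesis HX : C1_along X w0 A M.

Lemma C1_along_bound_nonneg : 0 <= M.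
Proof.
  destruct HX as [Hb _]; destruct (Hb 0 ltac:(lra)) as [_ [Hn _]].
  assert (H := norm_ge_0 (X (w0 0))); lra.
Qed.

Lemma C1_along_lipschitz :
  exists r, 0 < r /\ forall s z, 0 <= s <= 1 -> norm (minus z (w0 s)) < r ->
    norm (minus (X z) (X (w0 s))) <= (M + 1) * norm (minus z (w0 s)).
Proof.
  destruct HX as [Hb Hd]; destruct (Hd 1 Rlt_0_1) as [r [Hr Hz]].
  exists r; split; auto; intros s z Hs Hzs.
  destruct (Hb s Hs) as [_ [_ HA]].
  specialize (Hz s z Hs Hzs); specialize (HA (minus z (w0 s))).
  replace (minus (X z) (X (w0 s))) with
    (plus (minus (minus (X z) (X (w0 s))) (A s (minus z (w0 s))))
       (A s (minus z (w0 s)))) by module_ring W.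
  eapply Rle_trans; [apply norm_plus_le|]; lra.
Qed.

Lemma C1_along_continuous (s : R) : 0 <= s <= 1 -> continuous X (w0 s).
Proof.
  intros Hs; destruct C1_along_lipschitz as [r [Hr HL]].
  assert (HM := C1_along_bound_nonneg).
  apply continuous_norm_iff; intros e He.
  assert (HeM : 0 < e / (M + 1)) by (apply Rdiv_lt_0_compat; lra).
  exists (Rmin r (e / (M + 1))); split; [now apply Rmin_glb_lt|].
  intros z Hz; apply Rmin_Rgt_l in Hz; destruct Hz as [Hz1 Hz2].
  eapply Rle_lt_trans; [apply (HL s z Hs Hz1)|].
  replace e with ((M + 1) * (e / (M + 1))) by (field; lra).
  apply Rmult_lt_compat_l; [lra | exact Hz2].
Qed.

End C1Along.

Section Flow.
Context {V : NormedModule R_AbsRing}.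
Variables (X : V -> V) (w0 : R -> V) (A : R -> V -> V) (M mu0 : R).
Hypothesis HX : C1_along X w0 A M.

(** Gronwall's inequality, with the speed [mu] perturbed as well as the initial point. The case
    [m = 0] is included on purpose: it is uniqueness of solutions. *)
Lemma ode_stability :
  solves_on_unit X mu0 w0 ->
  exists C d, 0 < C /\ 0 < d /\
    forall w mu m, solves_on_unit X mu w -> 0 <= m < d ->
      norm (minus (w 0) (w0 0)) <= m -> Rabs (mu - mu0) <= m ->
      forall s, 0 <= s <= 1 -> norm (minus (w s) (w0 s)) <= C * m.
Proof.
  intros Hw0.
  assert (HM := C1_along_bound_nonneg _ _ _ _ HX).
  destruct (C1_along_lipschitz _ _ _ _ HX) as [r [Hr HL]].
  (* [(Rabs mu0 + 1) * (M + 1)] bounds the effect of the Lipschitz field at a speed within 1 of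
     [mu0], [M] the effect of changing the speed, and the last 1 makes the slope inequality
     strict. *)
  set (L := (Rabs mu0 + 1) * (M + 1) + M + 1).
  assert (Hmu0 := Rabs_pos mu0).
  assert (HLpos : 0 <= L) by (unfold L; nra).
  assert (Hexp := exp_pos L).
  (* The bound 1 controls the speed; the other keeps the barrier below [r], inside the tube where
     the field is Lipschitz. That [w] stays in the tube need not be known beforehand, as the barrier
     is examined only at contacts. *)
  set (d := Rmin 1 (r / (2 * exp L))).
  assert (Hd1 : d <= 1) by apply Rmin_l.
  assert (Hdr : d * (2 * exp L) <= r).
  { assert (Hm : d <= r / (2 * exp L)) by apply Rmin_r.
    apply (Rmult_le_compat_r (2 * exp L)) in Hm; [|lra].
    replace (r / (2 * exp L) * (2 * exp L)) with r in Hm; [lra|field; lra]. }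
  assert (Hd : 0 < d).
  { apply Rmin_glb_lt; [lra|]; apply Rdiv_lt_0_compat; lra. }
  exists (2 * exp L), d; split; [lra|]; split; auto.
  intros w mu m Hw Hm Hinit Hmu s Hs.
  (* The barrier has to start strictly above the initial deviation even if [m = 0]; so it is built
     from [m' > m], and [m'] then decreases to [m]. *)
  assert (Hstrict : forall m', m < m' < d ->
    norm (minus (w s) (w0 s)) <= 2 * exp L * m').
  { intros m' Hm'.
    assert (Hes := exp_scaled_bounds L s HLpos Hs).
    apply Rle_trans with (2 * m' * exp (L * s)); [|nra]; left.
    revert s Hs Hes.
    enough (Hall : forall s, 0 <= s <= 1 ->
      norm (minus (w s) (w0 s)) < 2 * m' * exp (L * s)) by auto.
    apply (norm_barrier (fun s => minus (w s) (w0 s))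
      (fun s => minus (scal mu (X (w s))) (scal mu0 (X (w0 s))))
      (fun s => 2 * m' * exp (L * s))
      (fun s => 2 * m' * L * exp (L * s))).
    - intros s Hs; exact (is_derive_minus w w0 s _ _ (Hw s Hs) (Hw0 s Hs)).
    - intros s _; apply is_derive_exp_scaled.
    - rewrite Rmult_0_r, exp_0; lra.
    - intros s Hs HB; cbv beta in *.
      assert (Hes := exp_scaled_bounds L s HLpos Hs).
      assert (Hin : norm (minus (w s) (w0 s)) < r) by nra.
      specialize (HL s (w s) Hs Hin); rewrite HB in HL.
      destruct (proj1 HX s Hs) as [_ [HXs _]].
      replace (minus (scal mu (X (w s))) (scal mu0 (X (w0 s)))) with
        (plus (scal mu (minus (X (w s)) (X (w0 s))))
          (scal (mu - mu0) (X (w0 s)))) by module_ring V.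
      eapply Rle_lt_trans; [apply norm_plus_le|].
      eapply Rle_lt_trans;
        [apply Rplus_le_compat; apply norm_scal_le|].
      assert (Hmu1 : Rabs mu <= Rabs mu0 + 1).
      { replace mu with ((mu - mu0) + mu0) by ring.
        eapply Rle_trans; [apply Rabs_triang|]; lra. }
      set (B := 2 * m' * exp (L * s)) in *.
      assert (HBm : m' < B) by (unfold B; nra).
      replace (2 * m' * L * exp (L * s)) with (L * B) by (unfold B; ring).
      assert (H1 : Rabs mu * norm (minus (X (w s)) (X (w0 s))) <=
        (Rabs mu0 + 1) * ((M + 1) * B)).
      { apply Rmult_le_compat; auto using Rabs_pos, norm_ge_0. }
      assert (H2 : Rabs (mu - mu0) * norm (X (w0 s)) <= m * M).
      { apply Rmult_le_compat; auto using Rabs_pos, norm_ge_0. }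
      unfold L; nra. }
  apply le_epsilon; intros eps Heps.
  set (m' := m + Rmin (eps / (2 * exp L)) ((d - m) / 2)).
  assert (Hp : 0 < Rmin (eps / (2 * exp L)) ((d - m) / 2)).
  { apply Rmin_glb_lt; [apply Rdiv_lt_0_compat|]; lra. }
  assert (Hp1 := Rmin_l (eps / (2 * exp L)) ((d - m) / 2)).
  assert (Hp2 := Rmin_r (eps / (2 * exp L)) ((d - m) / 2)).
  eapply Rle_trans; [apply (Hstrict m'); unfold m'; lra|].
  apply (Rmult_le_compat_r (2 * exp L)) in Hp1; [|lra].
  replace (eps / (2 * exp L) * (2 * exp L)) with eps in Hp1 by (field; lra).
  unfold m'; lra.
Qed.

(** Linearity makes the barrier argument work without any smallness of [r], so the bound is
    proportional to the defect [e]. In [flow_increments] the role of [r] is played by the failure of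
    a linear relation between increments. *)
Lemma linear_ode_bound :
  exists C, 0 < C /\
    forall r r' e, (forall s, 0 <= s <= 1 -> is_derive r s (r' s)) ->
      0 <= e -> norm (r 0) <= e ->
      (forall s, 0 <= s <= 1 ->
         norm (minus (r' s) (scal mu0 (A s (r s)))) <= e) ->
      forall s, 0 <= s <= 1 -> norm (r s) <= C * e.
Proof.
  assert (HM := C1_along_bound_nonneg _ _ _ _ HX).
  set (L := Rabs mu0 * M + 1).
  assert (Hmu0 := Rabs_pos mu0).
  assert (HLpos : 0 <= L) by (unfold L; nra).
  assert (Hexp := exp_pos L).
  exists (2 * exp L); split; [lra|].
  intros r r' e Hr He Hinit Hr' s Hs.
  assert (Hstrict : forall e', e < e' -> norm (r s) <= 2 * exp L * e').
  { intros e' He'.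
    assert (Hes := exp_scaled_bounds L s HLpos Hs).
    apply Rle_trans with (2 * e' * exp (L * s)); [|nra]; left.
    revert s Hs Hes.
    enough (Hall : forall s, 0 <= s <= 1 ->
      norm (r s) < 2 * e' * exp (L * s)) by auto.
    apply (norm_barrier r r' (fun s => 2 * e' * exp (L * s))
      (fun s => 2 * e' * L * exp (L * s))); auto.
    - intros s _; apply is_derive_exp_scaled.
    - rewrite Rmult_0_r, exp_0; lra.
    - intros s Hs HB; cbv beta in *.
      assert (Hes := exp_scaled_bounds L s HLpos Hs).
      specialize (Hr' s Hs).
      destruct (proj1 HX s Hs) as [_ [_ HA]]; specialize (HA (r s)).
      rewrite HB in HA.
      replace (r' s) with (plus (minus (r' s) (scal mu0 (A s (r s))))
        (scal mu0 (A s (r s)))) by module_ring V.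
      eapply Rle_lt_trans; [apply norm_plus_le|].
      assert (H1 := norm_scal_le mu0 (A s (r s))).
      set (B := 2 * e' * exp (L * s)) in *.
      assert (HBm : e' < B) by (unfold B; nra).
      replace (2 * e' * L * exp (L * s)) with (L * B) by (unfold B; ring).
      assert (H2 : Rabs mu0 * norm (A s (r s)) <= Rabs mu0 * (M * B)).
      { apply Rmult_le_compat_l; auto. }
      unfold L; nra. }
  apply le_epsilon; intros eps Heps.
  eapply Rle_trans; [apply (Hstrict (e + eps / (2 * exp L)))|].
  - assert (0 < eps / (2 * exp L)) by (apply Rdiv_lt_0_compat; lra); lra.
  - right; field; lra.
Qed.

End Flow.

Lemma filterdiff_lipschitz {U V : NormedModule R_AbsRing}
    (f : U -> V) (x : U) (l : U -> V) :
  filterdiff f (locally x) l ->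
  exists C d, 0 < C /\ 0 < d /\
    forall y, norm (minus y x) < d ->
      norm (minus (f y) (f x)) <= C * norm (minus y x).
Proof.
  intros Hf; apply filterdiff_norm_iff in Hf; destruct Hf as [Hl Hf].
  destruct (linear_norm l Hl) as [N [HN Hlin]].
  destruct (Hf 1 Rlt_0_1) as [d [Hd Hfd]].
  exists (N + 1), d; split; [lra|]; split; auto; intros y Hy.
  specialize (Hfd y Hy); specialize (Hlin (minus y x)).
  replace (minus (f y) (f x)) with
    (plus (minus (minus (f y) (f x)) (l (minus y x))) (l (minus y x)))
    by module_ring V.
  eapply Rle_trans; [apply norm_plus_le|]; lra.
Qed.

Section FlowFamily.
Context {P V : NormedModule R_AbsRing}.
Variables (X : V -> V) (w : P -> R -> V) (mu : P -> R) (p : P).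
Variables (A : R -> V -> V) (M : R) (l0 : P -> V) (m0 : P -> R).
Hypothesis HX : C1_along X (w p) A M.
Hypothesis Hsol : locally p (fun q => solves_on_unit X (mu q) (w q)).
Hypothesis Hinit : filterdiff (fun q => w q 0) (locally p) l0.
Hypothesis Hmu : filterdiff mu (locally p) m0.

Lemma family_solves_near :
  exists d, 0 < d /\ forall q, norm (minus q p) < d ->
    solves_on_unit X (mu q) (w q).
Proof. now apply locally_norm_iff in Hsol. Qed.

Lemma family_solves_center : solves_on_unit X (mu p) (w p).
Proof.
  destruct family_solves_near as [d [Hd H]]; apply H.
  now rewrite norm_minus_self.
Qed.

Lemma flow_lipschitz :
  exists C d, 0 < C /\ 0 < d /\
    forall q s, norm (minus q p) < d -> 0 <= s <= 1 ->
      norm (minus (w q s) (w p s)) <= C * norm (minus q p).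
Proof.
  destruct (ode_stability X (w p) A M (mu p) HX family_solves_center)
    as [C [d [HC [Hd Hst]]]].
  destruct family_solves_near as [d1 [Hd1 H1]].
  destruct (filterdiff_lipschitz _ _ _ Hinit) as [C2 [d2 [HC2 [Hd2 H2]]]].
  destruct (filterdiff_lipschitz _ _ _ Hmu) as [C3 [d3 [HC3 [Hd3 H3]]]].
  (* [C2] and [C3] are the Lipschitz constants of the initial point and of the speed;
     [ode_stability] is applied with [m = K * norm (minus q p)]. *)
  set (K := C2 + C3).
  assert (HK : 0 < d / K) by (apply Rdiv_lt_0_compat; unfold K; lra).
  exists (C * K), (Rmin (Rmin d1 d2) (Rmin d3 (d / K))).
  split; [unfold K; nra|]; split; [repeat apply Rmin_glb_lt; auto|].
  intros q s Hq Hs.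
  apply Rmin_Rgt_l in Hq; destruct Hq as [Hq1 Hq2].
  apply Rmin_Rgt_l in Hq1; apply Rmin_Rgt_l in Hq2.
  assert (Hn := norm_ge_0 (minus q p)).
  specialize (H2 q ltac:(lra)); specialize (H3 q ltac:(lra)).
  rewrite Rmult_assoc.
  apply (Hst (w q) (mu q) (K * norm (minus q p))); auto.
  - apply H1; lra.
  - split; [unfold K; nra|].
    replace d with (K * (d / K)) by (field; unfold K; lra).
    apply Rmult_lt_compat_l; [unfold K; lra|]; lra.
  - unfold K; nra.
  - change (Rabs (mu q - mu p) <= C3 * norm (minus q p)) in H3.
    unfold K; nra.
Qed.

Lemma flow_linearized :
  forall e, 0 < e -> exists d, 0 < d /\
    forall q s, norm (minus q p) < d -> 0 <= s <= 1 ->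
      norm (minus (minus (scal (mu q) (X (w q s))) (scal (mu p) (X (w p s))))
        (plus (scal (mu p) (A s (minus (w q s) (w p s))))
           (scal (m0 (minus q p)) (X (w p s))))) <= e * norm (minus q p).
Proof.
  intros e He.
  destruct flow_lipschitz as [C [d [HC [Hd Hlip]]]].
  destruct (C1_along_lipschitz _ _ _ _ HX) as [r [Hr HL]].
  assert (HM := C1_along_bound_nonneg _ _ _ _ HX).
  destruct (filterdiff_lipschitz _ _ _ Hmu) as [C3 [d3 [HC3 [Hd3 H3]]]].
  assert (Hmup := Rabs_pos (mu p)).
  assert (HMC : 0 < 3 * (M + 1)) by lra.
  destruct (proj2 (proj1 (filterdiff_norm_iff _ _ _) Hmu) (e / (3 * (M + 1))))
    as [d4 [Hd4 H4]]; [now apply Rdiv_lt_0_compat|].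
  assert (HmC : 0 < 3 * (Rabs (mu p) + 1) * C) by nra.
  destruct (proj2 HX (e / (3 * (Rabs (mu p) + 1) * C)))
    as [d5 [Hd5 H5]]; [now apply Rdiv_lt_0_compat|].
  assert (HCC : 0 < 3 * C3 * (M + 1) * C) by (repeat apply Rmult_lt_0_compat; lra).
  set (d6 := e / (3 * C3 * (M + 1) * C)).
  assert (Hd6 : 0 < d6) by (now apply Rdiv_lt_0_compat).
  exists (Rmin (Rmin (Rmin d (r / C)) (Rmin d3 d4)) (Rmin (d5 / C) d6)).
  split.
  { repeat apply Rmin_glb_lt; auto; now apply Rdiv_lt_0_compat. }
  intros q s Hq Hs.
  apply Rmin_Rgt_l in Hq; destruct Hq as [Hq Hq2].
  apply Rmin_Rgt_l in Hq; destruct Hq as [Hq Hq1].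
  apply Rmin_Rgt_l in Hq; destruct Hq as [Hqd Hqr].
  apply Rmin_Rgt_l in Hq1; destruct Hq1 as [Hq3 Hq4].
  apply Rmin_Rgt_l in Hq2; destruct Hq2 as [Hq5 Hq6].
  specialize (H3 q Hq3); specialize (H4 q Hq4); specialize (Hlip q s Hqd Hs).
  change (Rabs (mu q - mu p) <= C3 * norm (minus q p)) in H3.
  change (Rabs (mu q - mu p - m0 (minus q p)) <=
    e / (3 * (M + 1)) * norm (minus q p)) in H4.
  set (n := norm (minus q p)) in *.
  assert (Hn : 0 <= n) by apply norm_ge_0.
  assert (HCr : forall x, n < x / C -> C * n < x).
  { intros x Hx; replace x with (C * (x / C)) by (field; lra).
    now apply Rmult_lt_compat_l. }
  specialize (HL s (w q s) Hs ltac:(eapply Rle_lt_trans; eauto)).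
  specialize (H5 s (w q s) Hs ltac:(eapply Rle_lt_trans; eauto)).
  destruct (proj1 HX s Hs) as [_ [HXs _]].
  (* Three errors, each allotted [e / 3]: a product of the increments of speed and field, hence
     quadratic; the Taylor remainder of [X] along [w p]; the Taylor remainder of [mu]. *)
  replace (minus (minus (scal (mu q) (X (w q s))) (scal (mu p) (X (w p s))))
        (plus (scal (mu p) (A s (minus (w q s) (w p s))))
           (scal (m0 (minus q p)) (X (w p s)))))
  with (plus (plus
     (scal (mu q - mu p) (minus (X (w q s)) (X (w p s))))
     (scal (mu p) (minus (minus (X (w q s)) (X (w p s)))
        (A s (minus (w q s) (w p s))))))
     (scal (mu q - mu p - m0 (minus q p)) (X (w p s)))) by module_ring V.
  assert (E1 : Rabs (mu q - mu p) * norm (minus (X (w q s)) (X (w p s)))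
    <= e / 3 * n).
  { apply Rle_trans with ((C3 * n) * ((M + 1) * (C * n))).
    - apply Rmult_le_compat; auto using Rabs_pos, norm_ge_0.
      eapply Rle_trans; [exact HL|]; apply Rmult_le_compat_l; lra.
    - replace (C3 * n * ((M + 1) * (C * n))) with
        ((C3 * (M + 1) * C * n) * n) by ring.
      apply Rmult_le_compat_r; auto.
      replace (e / 3) with (C3 * (M + 1) * C * d6)
        by (unfold d6; field; repeat split; lra).
      apply Rmult_le_compat_l; [nra|lra]. }
  assert (E2 : Rabs (mu p) * norm (minus (minus (X (w q s)) (X (w p s)))
        (A s (minus (w q s) (w p s)))) <= e / 3 * n).
  { apply Rle_trans with
      ((Rabs (mu p) + 1) * (e / (3 * (Rabs (mu p) + 1) * C) * (C * n))).
    - apply Rmult_le_compat; auto using norm_ge_0; [lra|].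
      eapply Rle_trans; [exact H5|]; apply Rmult_le_compat_l; auto.
      left; now apply Rdiv_lt_0_compat.
    - right; field; lra. }
  assert (E3 : Rabs (mu q - mu p - m0 (minus q p)) * norm (X (w p s))
    <= e / 3 * n).
  { apply Rle_trans with ((e / (3 * (M + 1)) * n) * (M + 1)).
    - apply Rmult_le_compat; auto using Rabs_pos, norm_ge_0; lra.
    - right; field; lra. }
  eapply Rle_trans; [apply norm_plus_le|].
  eapply Rle_trans; [apply Rplus_le_compat_r, norm_plus_le|].
  eapply Rle_trans;
    [apply Rplus_le_compat; [apply Rplus_le_compat|]; apply norm_scal_le|].
  lra.
Qed.

(* Increments of the flow satisfy the linearised equation up to o(|q - p|), so
   a linear relation between increments of the parameter propagates along the
   flow; no solution of the linearised equation has to be constructed. *)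
Lemma flow_increments :
  forall e, 0 < e -> exists d, 0 < d /\
    forall q q1 q2 a b s, 0 <= s <= 1 ->
      norm (minus q p) < d -> norm (minus q1 p) < d -> norm (minus q2 p) < d ->
      minus q p = plus (scal a (minus q1 p)) (scal b (minus q2 p)) ->
      norm (minus (minus (w q s) (w p s))
        (plus (scal a (minus (w q1 s) (w p s)))
              (scal b (minus (w q2 s) (w p s))))) <=
      e * (norm (minus q p) + Rabs a * norm (minus q1 p) +
           Rabs b * norm (minus q2 p)).
Proof.
  intros e He.
  destruct (linear_ode_bound _ _ _ _ (mu p) HX) as [C [HC Hlin]].
  destruct (proj1 (filterdiff_norm_iff _ _ _) Hinit) as [Hl0 Hi].
  destruct (proj1 (filterdiff_norm_iff _ _ _) Hmu) as [Hm0 _].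
  assert (HeC : 0 < e / C) by now apply Rdiv_lt_0_compat.
  destruct (Hi (e / C) HeC) as [d1 [Hd1 H1]].
  destruct (flow_linearized (e / C) HeC) as [d2 [Hd2 H2]].
  destruct family_solves_near as [d3 [Hd3 H3]].
  exists (Rmin d1 (Rmin d2 d3)); split; [repeat apply Rmin_glb_lt; auto|].
  intros q q1 q2 a b s Hs Hq Hq1 Hq2 Hrel.
  assert (Hall : forall x, norm (minus x p) < Rmin d1 (Rmin d2 d3) ->
    norm (minus x p) < d1 /\ norm (minus x p) < d2 /\ norm (minus x p) < d3).
  { intros x Hx; apply Rmin_Rgt_l in Hx; destruct Hx as [Hx1 Hx2].
    apply Rmin_Rgt_l in Hx2; lra. }
  apply Hall in Hq; apply Hall in Hq1; apply Hall in Hq2.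
  set (N := norm (minus q p) + Rabs a * norm (minus q1 p) +
           Rabs b * norm (minus q2 p)).
  assert (HN : 0 <= N).
  { assert (Ha := Rabs_pos a); assert (Hb := Rabs_pos b).
    assert (H := norm_ge_0 (minus q p)); assert (H' := norm_ge_0 (minus q1 p)).
    assert (H'' := norm_ge_0 (minus q2 p)); unfold N; nra. }
  assert (Hcomb : forall x x1 x2 : V,
    norm x <= e / C * norm (minus q p) ->
    norm x1 <= e / C * norm (minus q1 p) ->
    norm x2 <= e / C * norm (minus q2 p) ->
    norm (minus x (plus (scal a x1) (scal b x2))) <= e / C * N).
  { intros x x1 x2 Hx Hx1 Hx2.
    eapply Rle_trans; [apply norm_minus_le|].
    eapply Rle_trans; [apply Rplus_le_compat_l, norm_plus_le|].
    eapply Rle_trans;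
      [apply Rplus_le_compat_l, Rplus_le_compat; apply norm_scal_le|].
    assert (Ha := Rabs_pos a); assert (Hb := Rabs_pos b); unfold N.
    apply (Rmult_le_compat_l _ _ _ Ha) in Hx1.
    apply (Rmult_le_compat_l _ _ _ Hb) in Hx2; nra. }
  replace (e * N) with (C * (e / C * N)) by (field; lra).
  apply (Hlin
    (fun s => minus (minus (w q s) (w p s))
        (plus (scal a (minus (w q1 s) (w p s)))
              (scal b (minus (w q2 s) (w p s)))))
    (fun s => minus
        (minus (scal (mu q) (X (w q s))) (scal (mu p) (X (w p s))))
        (plus
         (scal a
           (minus (scal (mu q1) (X (w q1 s))) (scal (mu p) (X (w p s)))))
         (scal b
           (minus (scal (mu q2) (X (w q2 s))) (scal (mu p) (X (w p s)))))))
    (e / C * N)); auto.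
  - assert (Hdiff : forall x, norm (minus x p) < d3 -> forall t, 0 <= t <= 1 ->
      is_derive (fun t => minus (w x t) (w p t)) t
        (minus (scal (mu x) (X (w x t))) (scal (mu p) (X (w p t))))).
    { intros x Hx t Ht; apply (is_derive_minus (w x) (w p)).
      - now apply H3.
      - now apply family_solves_center. }
    assert (Hscal : forall k x, norm (minus x p) < d3 ->
      forall t, 0 <= t <= 1 ->
      is_derive (fun t => scal k (minus (w x t) (w p t))) t
        (scal k (minus (scal (mu x) (X (w x t))) (scal (mu p) (X (w p t)))))).
    { intros k x Hx t Ht.
      unfold is_derive.
      eapply filterdiff_ext_lin;
        [apply (filterdiff_scal_r_fct k); [apply Rmult_comm | now apply Hdiff]|].
      intros y; cbv beta; module_ring V. }
    intros t Ht; apply (is_derive_minus (fun t => minus (w q t) (w p t))).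
    + now apply Hdiff.
    + apply (is_derive_plus (fun t => scal a (minus (w q1 t) (w p t)))
        (fun t => scal b (minus (w q2 t) (w p t)))); now apply Hscal.
  - nra.
  (* By [Hrel] the values of the linear map [l0] cancel in the combination, so each initial
     increment may be replaced by its Taylor remainder. *)
  - replace (minus (minus (w q 0) (w p 0))
        (plus (scal a (minus (w q1 0) (w p 0)))
              (scal b (minus (w q2 0) (w p 0)))))
    with (minus (minus (minus (w q 0) (w p 0)) (l0 (minus q p)))
        (plus (scal a (minus (minus (w q1 0) (w p 0)) (l0 (minus q1 p))))
              (scal b (minus (minus (w q2 0) (w p 0)) (l0 (minus q2 p)))))).
    + apply Hcomb; apply H1; tauto.
    + rewrite Hrel, (linear_plus l0 Hl0), !(linear_scal l0 Hl0).
      module_ring V.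
  - intros t Ht; destruct (proj1 HX t Ht) as [HA _].
    (* The same cancellation for the equation: the terms in [m0] drop out by [Hrel], and those in
       [A t] assemble into [A t] applied to the defect. Only the errors of [flow_linearized]
       remain. *)
    match goal with |- norm ?x <= _ => replace x with
      (minus
       (minus (minus (scal (mu q) (X (w q t))) (scal (mu p) (X (w p t))))
        (plus (scal (mu p) (A t (minus (w q t) (w p t))))
           (scal (m0 (minus q p)) (X (w p t)))))
       (plus (scal a
       (minus (minus (scal (mu q1) (X (w q1 t))) (scal (mu p) (X (w p t))))
        (plus (scal (mu p) (A t (minus (w q1 t) (w p t))))
           (scal (m0 (minus q1 p)) (X (w p t))))))
        (scal b
       (minus (minus (scal (mu q2) (X (w q2 t))) (scal (mu p) (X (w p t))))
        (plus (scal (mu p) (A t (minus (w q2 t) (w p t))))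
           (scal (m0 (minus q2 p)) (X (w p t))))))))
      end.
    + apply Hcomb; apply H2; tauto.
    + rewrite Hrel, (linear_plus m0 Hm0), !(linear_scal m0 Hm0).
      rewrite (linear_minus (A t) (minus (w q t) (w p t)) _ HA).
      rewrite (linear_plus (A t) HA), !(linear_scal (A t) HA).
      module_ring V.
Qed.

End FlowFamily.

(** * Product spaces, chain rules, and differentiability in the plane *)

Lemma norm_fst_le {U V : NormedModule R_AbsRing} (z : U * V) :
  norm (fst z) <= norm z.
Proof.
  destruct z as [u v]; eapply Rle_trans; [apply Rmax_l | apply norm_prod].
Qed.

Lemma norm_snd_le {U V : NormedModule R_AbsRing} (z : U * V) :
  norm (snd z) <= norm z.
Proof.
  destruct z as [u v]; eapply Rle_trans; [apply Rmax_r | apply norm_prod].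
Qed.

Lemma norm_pair_le {U V : NormedModule R_AbsRing} (u : U) (v : V) :
  norm ((u, v) : U * V) <= norm u + norm v.
Proof.
  assert (Hu := norm_ge_0 u); assert (Hv := norm_ge_0 v).
  change (sqrt (norm u ^ 2 + norm v ^ 2) <= norm u + norm v).
  rewrite <- (sqrt_pow2 (norm u + norm v)) by lra.
  apply sqrt_le_1_alt; nra.
Qed.

Lemma filterdiff_pair {U V W : NormedModule R_AbsRing} (f : U -> V) (g : U -> W)
    (x : U) (lf : U -> V) (lg : U -> W) :
  filterdiff f (locally x) lf -> filterdiff g (locally x) lg ->
  filterdiff (fun u => (f u, g u)) (locally x) (fun u => (lf u, lg u)).
Proof.
  intros Hf Hg.
  apply (filterdiff_comp'_2 f g (fun a b => (a, b)) x lf lg (fun a b => (a, b)));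
    auto.
  apply filterdiff_linear, is_linear_prod;
    [apply is_linear_fst | apply is_linear_snd].
Qed.

Lemma is_derive_comp_filterdiff {V W : NormedModule R_AbsRing} (g : V -> W)
    (f : R -> V) (s : R) (d : V) (l : V -> W) :
  filterdiff g (locally (f s)) l -> is_derive f s d ->
  is_derive (fun s => g (f s)) s (l d).
Proof.
  intros Hg Hf; unfold is_derive in *.
  eapply filterdiff_ext_lin;
    [apply (filterdiff_comp' f g s _ l Hf Hg)|].
  intros y; apply (linear_scal l (proj1 Hg)).
Qed.

Lemma is_derive_linear {V W : NormedModule R_AbsRing} (l : V -> W)
    (f : R -> V) (s : R) (d : V) :
  is_linear l -> is_derive f s d -> is_derive (fun s => l (f s)) s (l d).
Proof.
  intros Hl; apply is_derive_comp_filterdiff, filterdiff_linear, Hl.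
Qed.

Lemma is_derive_plus_const {V : NormedModule R_AbsRing} (f : R -> V) (c : V)
    (s : R) (d : V) :
  is_derive f s d -> is_derive (fun s => plus (f s) c) s d.
Proof.
  intros Hf; replace d with (plus d zero) by apply plus_zero_r.
  apply (is_derive_plus f (fun _ => c)); auto; apply is_derive_const.
Qed.

Lemma is_linear_coordinates (a b : R) :
  is_linear (fun h : R * R => fst h * a + snd h * b).
Proof.
  apply Build_is_linear.
  - intros x y; unfold plus; simpl; unfold plus; simpl; ring.
  - intros k x; unfold scal; simpl; unfold scal, mult; simpl; unfold mult;
      simpl; ring.
  - exists (Rabs a + Rabs b + 1).
    assert (Ha := Rabs_pos a); assert (Hb := Rabs_pos b); split; [lra|].
    intros x; change (Rabs (fst x * a + snd x * b) <=
      (Rabs a + Rabs b + 1) * norm x).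
    assert (H1 := norm_fst_le x : Rabs (fst x) <= norm x).
    assert (H2 := norm_snd_le x : Rabs (snd x) <= norm x).
    eapply Rle_trans; [apply Rabs_triang|]; rewrite !Rabs_mult.
    assert (Hx := norm_ge_0 x); nra.
Qed.

(* The partial difference quotients are Cauchy, and their limits are the
   entries of the differential. *)
Lemma asymptotically_linear_differentiable (g : R * R -> R) (p : R * R) :
  (forall e, 0 < e -> exists d, 0 < d /\
    forall (q q1 q2 : R * R) (a b : R),
      norm (minus q p) < d -> norm (minus q1 p) < d -> norm (minus q2 p) < d ->
      minus q p = plus (scal a (minus q1 p)) (scal b (minus q2 p)) ->
      Rabs (g q - g p - (a * (g q1 - g p) + b * (g q2 - g p))) <=
      e * (norm (minus q p) + Rabs a * norm (minus q1 p) +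
           Rabs b * norm (minus q2 p))) ->
  ex_filterdiff g (locally p).
Proof.
  intros Hg.
  set (t := fun n : nat => / (INR n + 1)).
  assert (Ht : forall n, 0 < t n).
  { intros n; apply Rinv_0_lt_compat; assert (H := pos_INR n); lra. }
  assert (Hsmall : forall (v : R * R) d, 0 < d -> exists N, forall n,
    (N <= n)%nat -> t n * norm v < d).
  { intros v d Hd; assert (Hv := norm_ge_0 v).
    destruct (nfloor_ex (norm v / d)) as [N HN].
    { apply Rdiv_le_0_compat; lra. }
    exists (S N); intros n Hn.
    apply le_INR in Hn; rewrite S_INR in Hn.
    assert (Hvd : norm v < (INR n + 1) * d).
    { replace (norm v) with (norm v / d * d) by (field; lra).
      apply Rmult_lt_compat_r; lra. }
    assert (Hp := pos_INR n).
    unfold t; apply (Rmult_lt_reg_l (INR n + 1)); [lra|].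
    rewrite <- Rmult_assoc, Rinv_r by lra; lra. }
  set (pt := fun (v : R * R) n => plus p (scal (t n) v)).
  assert (Hpt : forall v n, minus (pt v n) p = scal (t n) v).
  { intros v n; unfold pt.
    module_ring (prod_NormedModule R_AbsRing R_NormedModule R_NormedModule). }
  assert (Hptn : forall v n, norm (minus (pt v n) p) <= t n * norm v).
  { intros v n; rewrite Hpt.
    eapply Rle_trans;
      [apply (norm_scal_le (V := prod_NormedModule R_AbsRing
         R_NormedModule R_NormedModule))|].
    rewrite Rabs_pos_eq; [lra | left; apply Ht]. }
  set (D := fun v n => (g (pt v n) - g p) / t n).
  assert (Hlim : forall v, exists L, forall e, 0 < e -> exists N, forall n,
    (N <= n)%nat -> Rabs (D v n - L) < e).
  { intros v.
    assert (Hv := norm_ge_0 v).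
    destruct (proj2 (ex_lim_seq_cauchy_corr (D v))) as [L HL].
    - intros e.
      assert (Hev : 0 < e / (2 * (norm v + 1))).
      { apply Rdiv_lt_0_compat; [apply cond_pos | lra]. }
      destruct (Hg _ Hev) as [d [Hd Hgd]].
      destruct (Hsmall v d Hd) as [N HN].
      exists N; intros n m Hn Hm.
      assert (Htn := Ht n); assert (Htm := Ht m).
      assert (H1 := Hptn v n); assert (H2 := Hptn v m).
      assert (H3 := HN n Hn); assert (H4 := HN m Hm).
      (* Both points lie on the ray from [p] along [v], so their increments have ratio [t n / t m];
         repeating the second point with coefficient 0 turns the hypothesis into a comparison of two
         difference quotients. *)
      assert (Hk := Hgd (pt v n) (pt v m) (pt v m) (t n / t m) 0
        ltac:(lra) ltac:(lra) ltac:(lra)).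
      rewrite Rabs_R0, Rmult_0_l, Rmult_0_l, !Rplus_0_r in Hk.
      assert (Hnm : 0 < t n / t m) by now apply Rdiv_lt_0_compat.
      rewrite (Rabs_pos_eq (t n / t m)) in Hk by lra.
      assert (Hk' : Rabs (t n * (D v n - D v m)) <=
        e / (2 * (norm v + 1)) * (2 * t n * norm v)).
      { replace (t n * (D v n - D v m)) with
          (g (pt v n) - g p - t n / t m * (g (pt v m) - g p))
          by (unfold D; field; split; lra).
        eapply Rle_trans; [apply Hk|].
        - rewrite !Hpt.
          apply injective_projections; simpl; unfold plus, scal; simpl;
            unfold mult; simpl; field; lra.
        - apply Rmult_le_compat_l; [lra|].
          assert (t n / t m * norm (minus (pt v m) p) <= t n * norm v); [|lra].
          replace (t n * norm v) with (t n / t m * (t m * norm v))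
            by (field; lra).
          apply Rmult_le_compat_l; lra. }
      rewrite Rabs_mult, (Rabs_pos_eq (t n)) in Hk' by lra.
      apply (Rmult_lt_reg_l (t n)); auto.
      eapply Rle_lt_trans; [exact Hk'|].
      replace (e / (2 * (norm v + 1)) * (2 * t n * norm v)) with
        (t n * e * (norm v / (norm v + 1))) by (field; lra).
      assert (He := cond_pos e).
      assert (Hfrac : norm v / (norm v + 1) < 1).
      { apply (Rmult_lt_reg_r (norm v + 1)); [lra|].
        unfold Rdiv; rewrite Rmult_assoc, Rinv_l by lra; lra. }
      assert (0 < t n * e) by now apply Rmult_lt_0_compat.
      nra.
    - exists L; intros e He.
      destruct (proj2 (is_lim_seq_spec _ _) HL (mkposreal e He)) as [N HN].
      now exists N. }
  destruct (Hlim (1, 0)) as [L1 HL1]; destruct (Hlim (0, 1)) as [L2 HL2].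
  set (c1 := norm ((1, 0) : R * R)); set (c2 := norm ((0, 1) : R * R)).
  assert (Hc1 : 0 <= c1) by apply norm_ge_0.
  assert (Hc2 : 0 <= c2) by apply norm_ge_0.
  exists (fun h : R * R => fst h * L1 + snd h * L2).
  apply (proj2 (filterdiff_norm_iff g p (fun h => fst h * L1 + snd h * L2))); split.
  { apply is_linear_coordinates. }
  intros e He.
  (* [1 + c1 + c2] pays for the approximate linear relation and 2 for replacing the two quotients by
     their limits. *)
  set (e' := e / (3 + c1 + c2)).
  assert (He' : 0 < e') by (apply Rdiv_lt_0_compat; lra).
  destruct (Hg e' He') as [d [Hd Hgd]].
  exists d; split; auto; intros q Hq.
  destruct (HL1 e' He') as [N1 HN1]; destruct (HL2 e' He') as [N2 HN2].
  destruct (Hsmall (1, 0) d Hd) as [N3 HN3].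
  destruct (Hsmall (0, 1) d Hd) as [N4 HN4].
  set (n := (N1 + N2 + N3 + N4)%nat).
  specialize (HN1 n ltac:(unfold n; lia)); specialize (HN2 n ltac:(unfold n; lia)).
  specialize (HN3 n ltac:(unfold n; lia)); specialize (HN4 n ltac:(unfold n; lia)).
  assert (P1 := Hptn (1, 0) n); assert (P2 := Hptn (0, 1) n).
  assert (Htn := Ht n).
  set (h := minus q p) in *.
  assert (Hh1 := norm_fst_le h : Rabs (fst h) <= norm h).
  assert (Hh2 := norm_snd_le h : Rabs (snd h) <= norm h).
  assert (Hk := Hgd q (pt (1, 0) n) (pt (0, 1) n) (fst h / t n) (snd h / t n)
        Hq ltac:(lra) ltac:(lra)).
  fold c1 in P1; fold c2 in P2.
  change (Rabs (g q - g p - (fst h * L1 + snd h * L2)) <= e * norm h).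
  replace (g q - g p - (fst h * L1 + snd h * L2)) with
    (g q - g p - (fst h / t n * (g (pt (1, 0) n) - g p) +
       snd h / t n * (g (pt (0, 1) n) - g p))
     + (fst h * (D (1, 0) n - L1) + snd h * (D (0, 1) n - L2)))
    by (unfold D; field; lra).
  eapply Rle_trans; [apply Rabs_triang|].
  assert (Hsecond : Rabs (fst h * (D (1, 0) n - L1) + snd h * (D (0, 1) n - L2))
    <= 2 * e' * norm h).
  { eapply Rle_trans; [apply Rabs_triang|]; rewrite !Rabs_mult.
    assert (Rabs (fst h) * Rabs (D (1, 0) n - L1) <= norm h * e').
    { apply Rmult_le_compat; auto using Rabs_pos; lra. }
    assert (Rabs (snd h) * Rabs (D (0, 1) n - L2) <= norm h * e').
    { apply Rmult_le_compat; auto using Rabs_pos; lra. }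
    lra. }
  (* The coefficients [fst h / t n] and [snd h / t n] grow with [n], but the points they multiply
     approach [p] at the rate [t n]: the products are bounded independently of [n]. *)
  assert (Hquot : forall x z c, Rabs x <= norm h -> 0 <= z <= t n * c -> 0 <= c ->
    Rabs (x / t n) * z <= norm h * c).
  { intros x z c Hx Hz Hc; unfold Rdiv; rewrite Rabs_mult.
    rewrite (Rabs_pos_eq (/ t n)) by (left; now apply Rinv_0_lt_compat).
    rewrite Rmult_assoc; apply Rmult_le_compat; auto using Rabs_pos.
    - apply Rmult_le_pos; [left; now apply Rinv_0_lt_compat | tauto].
    - apply (Rmult_le_reg_l (t n)); auto.
      rewrite <- Rmult_assoc, Rinv_r by lra; lra. }
  assert (Hq1 := Hquot _ _ _ Hh1 (conj (norm_ge_0 _) P1) Hc1).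
  assert (Hq2 := Hquot _ _ _ Hh2 (conj (norm_ge_0 _) P2) Hc2).
  apply Rle_trans with (e' * (norm h + norm h * c1 + norm h * c2)
    + 2 * e' * norm h).
  - apply Rplus_le_compat; auto.
    eapply Rle_trans; [apply Hk|].
    + rewrite !Hpt.
      apply injective_projections; simpl; unfold plus, scal; simpl;
        unfold mult, opp; simpl; field; lra.
    + apply Rmult_le_compat_l; [lra|].
      exact (Rplus_le_compat _ _ _ _
        (Rplus_le_compat _ _ _ _ (Rle_refl _) Hq1) Hq2).
  - right; unfold e'; field; lra.
Qed.

(** * Uniform differentiability along a curve *)

(** Exactly the derivative in the recursion of [C_on], so smoothness hypotheses apply to it by
    conversion. *)
Definition dir_derive {V : NormedModule R_AbsRing} (f : V -> R) (p v : V) : R :=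
  Derive (fun s => f (plus p (scal s v))) 0.

Lemma is_derive_line {V : NormedModule R_AbsRing} (f : V -> R) (p v : V) (u : R)
    (l : V -> R) :
  filterdiff f (locally (plus p (scal u v))) l ->
  is_derive (fun s => f (plus p (scal s v))) u (l v).
Proof.
  intros Hf.
  assert (Hline : is_derive (fun s : R => plus p (scal s v)) u v).
  { evar_last.
    - apply (is_derive_plus (fun _ => p) (fun s => scal s v)).
      + apply is_derive_const.
      + apply (is_derive_scal_l (fun s : R => s) u 1 v).
        exact (is_derive_id (u : R_AbsRing)).
    - module_ring V. }
  exact (is_derive_comp_filterdiff f _ u v l Hf Hline).
Qed.

Lemma filterdiff_dir_derive {V : NormedModule R_AbsRing} (f : V -> R) (p : V) :
  ex_filterdiff f (locally p) -> filterdiff f (locally p) (dir_derive f p).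
Proof.
  intros [l Hl]; apply (filterdiff_ext_lin f l); auto.
  intros v; symmetry; apply is_derive_unique, is_derive_line.
  replace (plus p (scal 0 v)) with p by module_ring V; exact Hl.
Qed.

Lemma C_on_ext {V : NormedModule R_AbsRing} (k : nat) (A : V -> Prop)
    (f g : V -> R) :
  (forall p, f p = g p) -> C_on k A f -> C_on k A g.
Proof.
  revert f g; induction k as [|k IH]; intros f g Hfg; simpl.
  - intros Hf p Hp; apply (continuous_ext f g p Hfg), Hf, Hp.
  - intros [Hd Hv]; split.
    + intros p Hp; destruct (Hd p Hp) as [l Hl]; exists l.
      now apply (filterdiff_ext f).
    + intros v; apply (IH (fun p => Derive (fun s => f (plus p (scal s v))) 0));
        auto.
      intros p; apply Derive_ext; auto.
Qed.

(** The derivative of [f] after [l] along [v] is the derivative of [f] along [l v], again composed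
    with [l]; this is why the induction closes. *)
Lemma C_on_comp_linear {U V : NormedModule R_AbsRing} (k : nat) (A : V -> Prop)
    (f : V -> R) (l : U -> V) :
  is_linear l -> C_on k A f -> C_on k (fun u => A (l u)) (fun u => f (l u)).
Proof.
  intros Hl; revert f; induction k as [|k IH]; intros f; simpl.
  - intros Hf p Hp; apply (continuous_comp l f); [now apply linear_cont | auto].
  - intros [Hd Hv]; split.
    + intros p Hp; destruct (Hd _ Hp) as [df Hdf].
      exists (fun u => df (l u)).
      apply (filterdiff_comp' l f p l df); auto; now apply filterdiff_linear.
    + intros v; apply (C_on_ext k _
        (fun p => Derive (fun s => f (plus (l p) (scal s (l v)))) 0)).
      * intros p; apply Derive_ext; intros s.
        now rewrite (linear_plus l Hl), (linear_scal l Hl).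
      * apply (IH (fun p => Derive (fun s => f (plus p (scal s (l v)))) 0)), Hv.
Qed.

Lemma phase_linear_expand (l : R * R * R * R -> R) (v : R * R * R * R) :
  is_linear l ->
  l v = x_of v * l (1, 0, 0, 0) + t_of v * l (0, 1, 0, 0) +
        y_of v * l (0, 0, 1, 0) + E_of v * l (0, 0, 0, 1).
Proof.
  intros Hl; destruct v as [[[x t] y] E]; simpl.
  replace ((x, t, y, E) : R * R * R * R) with
    (plus (plus (plus (scal x ((1, 0, 0, 0) : R * R * R * R))
                      (scal t ((0, 1, 0, 0) : R * R * R * R)))
                (scal y ((0, 0, 1, 0) : R * R * R * R)))
          (scal E ((0, 0, 0, 1) : R * R * R * R))).
  - rewrite !(linear_plus l Hl), !(linear_scal l Hl); reflexivity.
  - repeat apply injective_projections; simpl; unfold plus, scal; simpl;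
      unfold mult; simpl; ring.
Qed.

Lemma x_of_norm (v : R * R * R * R) : Rabs (x_of v) <= norm v.
Proof.
  destruct v as [[[x t] y] E]; simpl.
  eapply Rle_trans; [|apply (norm_fst_le ((x, t, y, E) : R * R * R * R))].
  eapply Rle_trans; [|apply (norm_fst_le ((x, t, y) : R * R * R))].
  apply (norm_fst_le ((x, t) : R * R)).
Qed.

Lemma t_of_norm (v : R * R * R * R) : Rabs (t_of v) <= norm v.
Proof.
  destruct v as [[[x t] y] E]; simpl.
  eapply Rle_trans; [|apply (norm_fst_le ((x, t, y, E) : R * R * R * R))].
  eapply Rle_trans; [|apply (norm_fst_le ((x, t, y) : R * R * R))].
  apply (norm_snd_le ((x, t) : R * R)).
Qed.

Lemma y_of_norm (v : R * R * R * R) : Rabs (y_of v) <= norm v.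
Proof.
  destruct v as [[[x t] y] E]; simpl.
  eapply Rle_trans; [|apply (norm_fst_le ((x, t, y, E) : R * R * R * R))].
  apply (norm_snd_le ((x, t, y) : R * R * R)).
Qed.

Lemma E_of_norm (v : R * R * R * R) : Rabs (E_of v) <= norm v.
Proof.
  destruct v as [[[x t] y] E]; simpl.
  apply (norm_snd_le ((x, t, y, E) : R * R * R * R)).
Qed.

(* Finite-dimensionality, in the form in which it upgrades continuity of each
   directional derivative to continuity of the differential in operator norm. *)
Definition controlled_by {V : NormedModule R_AbsRing} (bs : list V) (C : R) :
    Prop :=
  0 < C /\
  forall (l1 l2 : V -> R) (e : R), is_linear l1 -> is_linear l2 ->
    (forall b, In b bs -> Rabs (l1 b - l2 b) < e) ->
    forall v, Rabs (l1 v - l2 v) <= C * e * norm v.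

Lemma phase_controlled :
  controlled_by ((1, 0, 0, 0) :: (0, 1, 0, 0) :: (0, 0, 1, 0) ::
    (0, 0, 0, 1) :: nil : list (R * R * R * R)) 4.
Proof.
  split; [lra|]; intros l1 l2 e Hl1 Hl2 Hb v.
  rewrite (phase_linear_expand l1 v Hl1), (phase_linear_expand l2 v Hl2).
  set (n := norm v).
  assert (Hprod : forall c a b, Rabs c <= n -> Rabs (a - b) < e ->
    Rabs (c * a - c * b) <= e * n).
  { intros c a b Hc Hab; replace (c * a - c * b) with (c * (a - b)) by ring.
    rewrite Rabs_mult, Rmult_comm; apply Rmult_le_compat; auto using Rabs_pos.
    lra. }
  simpl in Hb.
  assert (P1 := Hprod _ _ _ (x_of_norm v)
    (Hb (1, 0, 0, 0) ltac:(auto 6))).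
  assert (P2 := Hprod _ _ _ (t_of_norm v)
    (Hb (0, 1, 0, 0) ltac:(auto 6))).
  assert (P3 := Hprod _ _ _ (y_of_norm v)
    (Hb (0, 0, 1, 0) ltac:(auto 6))).
  assert (P4 := Hprod _ _ _ (E_of_norm v)
    (Hb (0, 0, 0, 1) ltac:(auto 6))).
  apply Rabs_le_between in P1; apply Rabs_le_between in P2.
  apply Rabs_le_between in P3; apply Rabs_le_between in P4.
  apply Rabs_le; lra.
Qed.

Section C1Open.
Context {V : NormedModule R_AbsRing}.
Variables (bs : list V) (C : R) (A : V -> Prop) (f : V -> R).
Hypothesis V_controlled : controlled_by bs C.
Hypothesis A_open : open A.
Hypothesis f_C1 : C_on 1 A f.

Lemma dir_derive_linear (z : V) : A z -> is_linear (dir_derive f z).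
Proof.
  intros Hz; exact (proj1 (filterdiff_dir_derive f z (proj1 f_C1 z Hz))).
Qed.

Lemma dir_derive_continuous (z0 : V) (e : R) :
  A z0 -> 0 < e -> exists d, 0 < d /\
    forall z, norm (minus z z0) < d ->
      A z /\ forall v, Rabs (dir_derive f z v - dir_derive f z0 v) <= e * norm v.
Proof.
  intros Hz0 He; destruct V_controlled as [HC Hcontrol].
  assert (HeC : 0 < e / C) by now apply Rdiv_lt_0_compat.
  assert (Hall : forall l : list V, exists d, 0 < d /\
    forall z, norm (minus z z0) < d -> forall b, In b l ->
      Rabs (dir_derive f z b - dir_derive f z0 b) < e / C).
  { induction l as [|v l [d [Hd H]]].
    - exists 1; split; [lra|]; intros z _ b [].
    - destruct (proj1 (continuous_norm_iff (fun z => dir_derive f z v) z0)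
        (proj2 f_C1 v z0 Hz0) (e / C) HeC) as [d' [Hd' H']].
      exists (Rmin d d'); split; [now apply Rmin_glb_lt|].
      intros z Hz b Hb; apply Rmin_Rgt_l in Hz; destruct Hz as [Hz Hz'].
      destruct Hb as [<- | Hb]; [exact (H' z Hz') | now apply H]. }
  destruct (Hall bs) as [d [Hd H]].
  destruct (proj1 (locally_norm_iff A z0) (A_open z0 Hz0)) as [d' [Hd' HA]].
  exists (Rmin d d'); split; [now apply Rmin_glb_lt|].
  intros z Hz; apply Rmin_Rgt_l in Hz; destruct Hz as [Hz Hz'].
  split; [now apply HA|]; intros v.
  replace e with (C * (e / C)) by (field; lra).
  apply (Hcontrol (dir_derive f z) (dir_derive f z0) (e / C)); auto.
  - apply dir_derive_linear; auto.
  - apply dir_derive_linear; auto.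
Qed.

(** Mean value theorem on the segment from [z] to [z']. The base point [z] varies too, which is what
    lets one radius serve for all nearby points of a curve. *)
Lemma C1_strictly_differentiable (z0 : V) (e : R) :
  A z0 -> 0 < e -> exists d, 0 < d /\
    forall z z' : V, norm (minus z z0) < d -> norm (minus z' z0) < d ->
      Rabs (f z' - f z - dir_derive f z (minus z' z)) <= e * norm (minus z' z).
Proof.
  intros Hz0 He.
  (* Half of [e] for the differential at the mean value point against that at [z0], half for the one
     at [z]. *)
  destruct (dir_derive_continuous z0 (e / 2) Hz0 ltac:(lra)) as [d [Hd Hnear]].
  exists d; split; auto; intros z z' Hz Hz'.
  set (v := minus z' z).
  assert (Hseg : forall u, 0 <= u <= 1 ->
    norm (minus (plus z (scal u v)) z0) < d).
  { intros u Hu.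
    replace (minus (plus z (scal u v)) z0) with
      (plus (scal (1 - u) (minus z z0)) (scal u (minus z' z0)))
      by (unfold v; module_ring V).
    eapply Rle_lt_trans; [apply norm_plus_le|].
    eapply Rle_lt_trans; [apply Rplus_le_compat; apply norm_scal_le|].
    rewrite !Rabs_pos_eq by lra.
    assert (N1 := norm_ge_0 (minus z z0)); assert (N2 := norm_ge_0 (minus z' z0)).
    destruct (Req_dec u 1) as [->|Hu1]; [lra|].
    assert ((1 - u) * norm (minus z z0) < (1 - u) * d)
      by (apply Rmult_lt_compat_l; lra).
    assert (u * norm (minus z' z0) <= u * d)
      by (apply Rmult_le_compat_l; lra).
    lra. }
  assert (Hder : forall u, 0 <= u <= 1 -> is_derive
    (fun s => f (plus z (scal s v))) u (dir_derive f (plus z (scal u v)) v)).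
  { intros u Hu; apply is_derive_line, filterdiff_dir_derive, (proj1 f_C1).
    apply (Hnear _ (Hseg u Hu)). }
  destruct (MVT_gen (fun s => f (plus z (scal s v))) 0 1
    (fun u => dir_derive f (plus z (scal u v)) v)) as [c [Hc Hmvt]].
  { intros u Hu; rewrite Rmin_left, Rmax_right in Hu by lra; apply Hder; lra. }
  { intros u Hu; rewrite Rmin_left, Rmax_right in Hu by lra.
    apply continuity_pt_filterlim.
    apply (ex_derive_continuous (fun s => f (plus z (scal s v)))).
    eexists; apply Hder; lra. }
  rewrite Rmin_left, Rmax_right in Hc by lra.
  replace (plus z (scal 1 v)) with z' in Hmvt
    by (unfold v; module_ring V).
  replace (plus z (scal 0 v)) with z in Hmvt
    by (unfold v; module_ring V).
  rewrite Hmvt.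
  destruct (Hnear _ (Hseg c Hc)) as [_ H1]; specialize (H1 v).
  destruct (Hnear _ Hz) as [_ H2]; specialize (H2 v).
  apply Rabs_le_between in H1; apply Rabs_le_between in H2.
  apply Rabs_le; lra.
Qed.

Lemma C1_along_of_C_on (w : R -> V) :
  (forall s, 0 <= s <= 1 -> continuous w s /\ A (w s)) ->
  exists M, C1_along f w (fun s => dir_derive f (w s)) M.
Proof.
  intros Hw.
  assert (Hnear : forall s0 e, 0 <= s0 <= 1 -> 0 < e -> exists d, 0 < d /\
    forall s, Rabs (s - s0) < d -> norm (minus (w s) (w s0)) < e).
  { intros s0 e Hs0 He.
    exact (proj1 (continuous_norm_iff w s0) (proj1 (Hw s0 Hs0)) e He). }
  (* The bound is encoded as [/ d], so that shrinking [d] weakens the condition, as the compactness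
     lemma requires. *)
  destruct (unit_interval_uniform (fun s d => Rabs (f (w s)) <= / d /\
    forall v, Rabs (dir_derive f (w s) v) <= / d * norm v)) as [d0 [Hd0 H0]].
  { intros s d d' [H1 H2] Hd.
    assert (Hinv : / d <= / d') by (apply Rinv_le_contravar; tauto).
    split; [lra|]; intros v; eapply Rle_trans; [apply H2|].
    apply Rmult_le_compat_r; auto; apply norm_ge_0. }
  { intros s0 Hs0; destruct (Hw s0 Hs0) as [_ Hz0].
    destruct (dir_derive_continuous (w s0) 1 Hz0 Rlt_0_1) as [d1 [Hd1 H1]].
    destruct (linear_norm _ (dir_derive_linear _ Hz0)) as [N [HN H2]].
    destruct (proj1 (continuous_norm_iff f (w s0))
      (filterdiff_continuous f _ (proj1 f_C1 _ Hz0)) 1 Rlt_0_1)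
      as [d2 [Hd2 H3]].
    destruct (Hnear s0 (Rmin d1 d2) Hs0) as [d3 [Hd3 H4]];
      [now apply Rmin_glb_lt|].
    set (K := Rabs (f (w s0)) + N + 1).
    assert (HK : 0 < K) by (unfold K; assert (H := Rabs_pos (f (w s0))); lra).
    exists (Rmin d3 (/ K)); split;
      [apply Rmin_glb_lt; auto; now apply Rinv_0_lt_compat|].
    intros s _ Hs; apply Rmin_Rgt_l in Hs; destruct Hs as [Hs _].
    specialize (H4 s Hs); apply Rmin_Rgt_l in H4; destruct H4 as [H4 H5].
    assert (HKd : K <= / Rmin d3 (/ K)).
    { rewrite <- (Rinv_inv K) at 1; apply Rinv_le_contravar; [|apply Rmin_r].
      apply Rmin_glb_lt; auto; now apply Rinv_0_lt_compat. }
    specialize (H3 _ H5); change (Rabs (f (w s) - f (w s0)) < 1) in H3.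
    split.
    - replace (f (w s)) with (f (w s) - f (w s0) + f (w s0)) by ring.
      eapply Rle_trans; [apply Rabs_triang|]; unfold K in HKd at 1; lra.
    - intros v; destruct (H1 _ H4) as [_ H6]; specialize (H6 v).
      specialize (H2 v); change (Rabs (dir_derive f (w s0) v) <= N * norm v) in H2.
      assert (Hv := norm_ge_0 v).
      apply Rle_trans with (K * norm v); [|now apply Rmult_le_compat_r].
      replace (dir_derive f (w s) v) with
        (dir_derive f (w s) v - dir_derive f (w s0) v + dir_derive f (w s0) v)
        by ring.
      eapply Rle_trans; [apply Rabs_triang|].
      assert (H := Rabs_pos (f (w s0))); unfold K; nra. }
  exists (/ d0); split.
  - intros s Hs; destruct (H0 s Hs) as [H1 H2].
    split; [apply dir_derive_linear, Hw, Hs | auto].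
  - intros e He.
    destruct (unit_interval_uniform (fun s d => forall z,
      norm (minus z (w s)) < d ->
      Rabs (f z - f (w s) - dir_derive f (w s) (minus z (w s))) <=
      e * norm (minus z (w s)))) as [d [Hd H]].
    { intros s d d' H1 Hd z Hz; apply H1; lra. }
    { intros s0 Hs0.
      destruct (C1_strictly_differentiable (w s0) e (proj2 (Hw s0 Hs0)) He)
        as [d1 [Hd1 H1]].
      (* With [w s] within [d1 / 2] of [w s0] and [z] within [d1 / 2] of [w s], both points lie in
         the ball of strict differentiability. *)
      destruct (Hnear s0 (d1 / 2) Hs0 ltac:(lra)) as [d2 [Hd2 H2]].
      exists (Rmin (d1 / 2) d2); split; [apply Rmin_glb_lt; lra|].
      intros s _ Hs z Hz.
      apply Rmin_Rgt_l in Hs; apply Rmin_Rgt_l in Hz.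
      specialize (H2 s (proj2 Hs)).
      apply H1; [lra|].
      replace (minus z (w s0)) with
        (plus (minus z (w s)) (minus (w s) (w s0)))
        by (module_ring V).
      eapply Rle_lt_trans; [apply norm_plus_le|]; lra. }
    exists d; split; auto; intros s z Hs Hz; now apply H.
Qed.

End C1Open.

Lemma C1_along_const {V W : NormedModule R_AbsRing} (c : W) (w : R -> V) :
  C1_along (fun _ => c) w (fun _ _ => zero) (norm c).
Proof.
  split.
  - intros s _; split; [apply is_linear_zero|]; split; [lra|].
    intros v; apply Rle_trans with 0; [right; apply (@norm_zero _ W)|].
    apply Rmult_le_pos; apply norm_ge_0.
  - intros e He; exists 1; split; [lra|]; intros s z _ _.
    assert (H0 : minus (minus c c) zero = (zero : W)) by module_ring W.
    apply Rle_trans with 0;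
      [right; exact (eq_trans (f_equal norm H0) (@norm_zero _ W))|].
    apply Rmult_le_pos; [lra | apply norm_ge_0].
Qed.

Lemma C1_along_opp {V W : NormedModule R_AbsRing} (X : V -> W) (w : R -> V)
    (A : R -> V -> W) (M : R) :
  C1_along X w A M ->
  C1_along (fun z => opp (X z)) w (fun s v => opp (A s v)) M.
Proof.
  intros [Hb Hd]; split.
  - intros s Hs; destruct (Hb s Hs) as [Hl [HX HA]]; split; [|split].
    + apply (is_linear_comp (A s) opp); auto; apply is_linear_opp.
    + rewrite (norm_opp (X (w s))); auto.
    + intros v; rewrite (norm_opp (A s v)); auto.
  - intros e He; destruct (Hd e He) as [d [Hd0 H]]; exists d; split; auto.
    intros s z Hs Hz; specialize (H s z Hs Hz).
    rewrite <- norm_opp in H.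
    replace (minus (minus (opp (X z)) (opp (X (w s))))
      (opp (A s (minus z (w s))))) with
      (opp (minus (minus (X z) (X (w s))) (A s (minus z (w s)))))
      by module_ring W.
    exact H.
Qed.

Lemma C1_along_pair {V W1 W2 : NormedModule R_AbsRing}
    (X1 : V -> W1) (X2 : V -> W2) (w : R -> V)
    (A1 : R -> V -> W1) (A2 : R -> V -> W2) (M1 M2 : R) :
  C1_along X1 w A1 M1 -> C1_along X2 w A2 M2 ->
  C1_along (fun z => (X1 z, X2 z)) w (fun s v => (A1 s v, A2 s v)) (M1 + M2).
Proof.
  intros [Hb1 Hd1] [Hb2 Hd2]; split.
  - intros s Hs; destruct (Hb1 s Hs) as [L1 [X1s B1]].
    destruct (Hb2 s Hs) as [L2 [X2s B2]]; split; [|split].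
    + now apply is_linear_prod.
    + eapply Rle_trans; [apply norm_pair_le | lra].
    + intros v; specialize (B1 v); specialize (B2 v).
      eapply Rle_trans; [apply norm_pair_le | lra].
  - intros e He.
    destruct (Hd1 (e / 2) ltac:(lra)) as [d1 [Hd1p H1]].
    destruct (Hd2 (e / 2) ltac:(lra)) as [d2 [Hd2p H2]].
    exists (Rmin d1 d2); split; [now apply Rmin_glb_lt|].
    intros s z Hs Hz; apply Rmin_Rgt_l in Hz; destruct Hz as [Hz1 Hz2].
    specialize (H1 s z Hs Hz1); specialize (H2 s z Hs Hz2).
    eapply Rle_trans;
      [apply (norm_pair_le
         (minus (minus (X1 z) (X1 (w s))) (A1 s (minus z (w s))))
         (minus (minus (X2 z) (X2 (w s))) (A2 s (minus z (w s)))))|].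
    lra.
Qed.

Lemma C1_along_ext {V W : NormedModule R_AbsRing} (X Y : V -> W) (w : R -> V)
    (A : R -> V -> W) (M : R) :
  (forall z, X z = Y z) -> C1_along X w A M -> C1_along Y w A M.
Proof.
  intros HXY [Hb Hd]; split.
  - intros s Hs; rewrite <- HXY; auto.
  - intros e He; destruct (Hd e He) as [d [Hd0 H]]; exists d; split; auto.
    intros s z Hs Hz; rewrite <- !HXY; auto.
Qed.

(** * Hamiltonian trajectories *)

Lemma x_of_linear : is_linear (x_of : R * R * R * R -> R).
Proof.
  apply (is_linear_ext (fun z : R * R * R * R => fst (fst (fst z)))).
  { now intros [[[x t] y] E]. }
  apply (is_linear_comp (fun z : R * R * R * R => fst (fst z)) fst);
    [|apply is_linear_fst].
  apply (is_linear_comp (fun z : R * R * R * R => fst z) fst); apply is_linear_fst.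
Qed.

Lemma t_of_linear : is_linear (t_of : R * R * R * R -> R).
Proof.
  apply (is_linear_ext (fun z : R * R * R * R => snd (fst (fst z)))).
  { now intros [[[x t] y] E]. }
  apply (is_linear_comp (fun z : R * R * R * R => fst (fst z)) snd);
    [|apply is_linear_snd].
  apply (is_linear_comp (fun z : R * R * R * R => fst z) fst); apply is_linear_fst.
Qed.

Lemma y_of_linear : is_linear (y_of : R * R * R * R -> R).
Proof.
  apply (is_linear_ext (fun z : R * R * R * R => snd (fst z))).
  { now intros [[[x t] y] E]. }
  apply (is_linear_comp (fun z : R * R * R * R => fst z) snd);
    [apply is_linear_fst | apply is_linear_snd].
Qed.

Lemma E_of_linear : is_linear (E_of : R * R * R * R -> R).
Proof.
  apply (is_linear_ext (fun z : R * R * R * R => snd z)).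
  { now intros [[[x t] y] E]. }
  apply is_linear_snd.
Qed.

Definition config_of (z : R * R * R * R) : R * R * R := (x_of z, y_of z, t_of z).

Lemma config_of_linear : is_linear config_of.
Proof.
  apply is_linear_prod; [apply is_linear_prod|];
    auto using x_of_linear, y_of_linear, t_of_linear.
Qed.

(** Both sides are limits of the same difference quotients, so no differentiability is involved. *)
Lemma Derive_shift (f : R -> R) (x : R) :
  Derive (fun s => f (x + s)) 0 = Derive f x.
Proof.
  unfold Derive; f_equal; apply Lim_ext; intros h.
  now rewrite Rplus_0_r, Rplus_0_l.
Qed.

Lemma eq_of_derive_const (g : R -> R) (c : R) :
  (forall s, 0 <= s <= 1 -> is_derive g s c) ->
  forall s, 0 <= s <= 1 -> g s = g 0 + s * c.
Proof.
  intros Hg s Hs.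
  destruct (MVT_gen g 0 s (fun _ => c)) as [u [_ Hu]].
  - intros u Hu; rewrite Rmin_left, Rmax_right in Hu by lra; apply Hg; lra.
  - intros u Hu; rewrite Rmin_left, Rmax_right in Hu by lra.
    apply continuity_pt_filterlim, (ex_derive_continuous g).
    exists c; apply Hg; lra.
  - lra.
Qed.

Section Hamiltonian.
Variables (D : R * R * R -> Prop) (H : R * R * R -> R).
Hypothesis D_open : open D.
Hypothesis H_smooth : smooth_on D H.

Definition in_domain (z : R * R * R * R) : Prop := D (config_of z).
Definition lifted (z : R * R * R * R) : R := H (config_of z).

Lemma in_domain_open : open in_domain.
Proof.
  apply (open_comp config_of D); auto.
  intros z _; apply (linear_cont config_of), config_of_linear.
Qed.

Lemma lifted_C_on (k : nat) : C_on k in_domain lifted.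
Proof. apply (C_on_comp_linear k D H config_of config_of_linear), H_smooth. Qed.

Lemma dir_derive_lifted_E (z : R * R * R * R) :
  dir_derive lifted z (0, 0, 0, 1) = 0.
Proof.
  destruct z as [[[x t] y] E]; unfold dir_derive.
  transitivity (Derive (fun _ => H (x, y, t)) 0); [|apply Derive_const].
  apply Derive_ext; intros s; unfold lifted; f_equal.
  repeat apply injective_projections; simpl; unfold plus, scal; simpl;
    unfold mult; simpl; ring.
Qed.

Lemma hamilton_field_dir_derive (z : R * R * R * R) :
  hamilton_field H z =
  (dir_derive lifted z (0, 0, 1, 0), 1,
   opp (dir_derive lifted z (1, 0, 0, 0)),
   opp (dir_derive lifted z (0, 1, 0, 0))).
Proof.
  destruct z as [[[x t] y] E]; unfold hamilton_field, dir_derive.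
  rewrite <- (Derive_shift (fun s => H (x, s, t)) y).
  rewrite <- (Derive_shift (fun s => H (s, y, t)) x).
  rewrite <- (Derive_shift (fun s => H (x, y, s)) t).
  unfold opp; simpl.
  apply f_equal2; [apply f_equal2; [apply f_equal2|]|];
    [|reflexivity|apply f_equal|apply f_equal];
  apply Derive_ext; intros s; unfold lifted; f_equal;
  repeat apply injective_projections; simpl; unfold plus, scal; simpl;
    unfold mult; simpl; ring.
Qed.

(** Hamilton's equations in invariant form: the 2-form dx dy + dt dE evaluated on (X, v) is the
    differential of H + E at v. The summand in [E_of v] is absent because [lifted] leaves out E. *)
Lemma dir_derive_lifted_field (z v : R * R * R * R) :
  in_domain z ->
  dir_derive lifted z v =
  - x_of v * y_of (hamilton_field H z) - t_of v * E_of (hamilton_field H z) +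
  y_of v * x_of (hamilton_field H z).
Proof.
  intros Hz.
  rewrite (phase_linear_expand _ v
    (dir_derive_linear _ _ (lifted_C_on 1) z Hz)).
  rewrite dir_derive_lifted_E, hamilton_field_dir_derive; simpl.
  unfold opp; simpl; ring.
Qed.

Lemma t_of_hamilton_field (z : phase) : t_of (hamilton_field H z) = 1.
Proof. now destruct z as [[[x t] y] E]. Qed.

Section Trajectory.
Variables (mu : R) (w : R -> R * R * R * R).
Hypothesis w_in : forall s, 0 <= s <= 1 -> in_domain (w s).
Hypothesis w_solves :
  solves_on_unit (hamilton_field H : R * R * R * R -> R * R * R * R) mu w.

Lemma trajectory_continuous (s : R) : 0 <= s <= 1 -> continuous w s.
Proof.
  intros Hs.
  exact (ex_derive_continuous w s (ex_intro _ _ (w_solves s Hs))).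
Qed.

Lemma lifted_C1_along :
  exists M, C1_along lifted w (fun s => dir_derive lifted (w s)) M.
Proof.
  apply (C1_along_of_C_on _ _ _ _ phase_controlled in_domain_open (lifted_C_on 1)).
  intros s Hs; split; [now apply trajectory_continuous | now apply w_in].
Qed.

Lemma hamilton_field_C1_along :
  exists A M,
    C1_along (hamilton_field H : R * R * R * R -> R * R * R * R) w A M.
Proof.
  assert (Hc : forall v, exists M, C1_along (fun z => dir_derive lifted z v) w
    (fun s => dir_derive (fun z => dir_derive lifted z v) (w s)) M).
  { intros v.
    apply (C1_along_of_C_on _ _ _ _ phase_controlled in_domain_open).
    (* The components of the field are derivatives of [lifted], so class C^2 is what makes the field
       C^1. *)
    - exact (proj2 (lifted_C_on 2) v).
    - intros s Hs; split; [now apply trajectory_continuous | now apply w_in]. }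
  destruct (Hc (0, 0, 1, 0)) as [M1 H1].
  destruct (Hc (1, 0, 0, 0)) as [M2 H2].
  destruct (Hc (0, 1, 0, 0)) as [M3 H3].
  assert (H4 := C1_along_pair _ _ _ _ _ _ _
    (C1_along_pair _ _ _ _ _ _ _
      (C1_along_pair _ _ _ _ _ _ _ H1 (C1_along_const (1 : R) w))
      (C1_along_opp _ _ _ _ H2)) (C1_along_opp _ _ _ _ H3)).
  eexists; eexists; refine (C1_along_ext _ _ _ _ _ _ H4).
  intros z; symmetry; apply hamilton_field_dir_derive.
Qed.

Lemma trajectory_derive (l : R * R * R * R -> R) (s : R) :
  is_linear l -> 0 <= s <= 1 ->
  is_derive (fun s => l (w s)) s (mu * l (hamilton_field H (w s))).
Proof.
  intros Hl Hs.
  replace (mu * l (hamilton_field H (w s))) with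
    (l (scal mu (hamilton_field H (w s) : R * R * R * R)))
    by apply (linear_scal l Hl).
  apply (is_derive_linear l w s); auto.
Qed.

Lemma trajectory_field_continuous (l : R * R * R * R -> R) (s : R) :
  is_linear l -> 0 <= s <= 1 ->
  continuous (fun s => l (hamilton_field H (w s))) s.
Proof.
  intros Hl Hs.
  destruct hamilton_field_C1_along as [A [M HC]].
  apply (continuous_comp w (fun z => l (hamilton_field H z))).
  { now apply trajectory_continuous. }
  apply (continuous_comp (hamilton_field H : R * R * R * R -> R * R * R * R) l).
  - exact (C1_along_continuous _ _ _ _ HC s Hs).
  - exact (linear_cont l _ Hl).
Qed.

Lemma trajectory_time (s : R) :
  0 <= s <= 1 -> t_of (w s) = t_of (w 0) + s * mu.
Proof.
  revert s; apply (eq_of_derive_const (fun s => t_of (w s)) mu).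
  intros s Hs.
  replace mu with (mu * t_of (hamilton_field H (w s)))
    by (rewrite t_of_hamilton_field; ring).
  apply (trajectory_derive t_of); auto using t_of_linear.
Qed.

(** The derivative of H + E along the field X is the 2-form on (X, X), which vanishes by
    antisymmetry. *)
Lemma trajectory_energy (s : R) :
  0 <= s <= 1 -> lifted (w s) + E_of (w s) = lifted (w 0) + E_of (w 0).
Proof.
  intros Hs0.
  enough (Hc : forall s, 0 <= s <= 1 ->
    is_derive (fun s => lifted (w s) + E_of (w s)) s 0).
  { assert (He := eq_of_derive_const _ 0 Hc s Hs0); cbv beta in He; lra. }
  clear s Hs0; intros s Hs.
  assert (Hin := w_in s Hs).
  replace 0 with
    (plus (dir_derive lifted (w s)
             (scal mu (hamilton_field H (w s) : R * R * R * R)))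
       (mu * E_of (hamilton_field H (w s)))).
  - apply (is_derive_plus (fun s => lifted (w s)) (fun s => E_of (w s))).
    + apply (is_derive_comp_filterdiff lifted w s); [|now apply w_solves].
      apply filterdiff_dir_derive, (lifted_C_on 1), Hin.
    + apply (trajectory_derive E_of); auto using E_of_linear.
  - rewrite (linear_scal _ (dir_derive_linear _ _ (lifted_C_on 1) _ Hin)).
    rewrite (dir_derive_lifted_field _ _ Hin), t_of_hamilton_field.
    unfold plus, scal; simpl; unfold mult; simpl; ring.
Qed.

End Trajectory.
End Hamiltonian.

(** * Variation of the action *)

(* The integral of [y dx + E dt] along a trajectory with time rescaled by
   [mu]; the energy term of the action vanishes on [H + E = 0]. *)
Definition action (H : config -> R) (mu : R) (w : R -> R * R * R * R) : R :=
  RInt (fun s => mu * (y_of (w s) * x_of (hamilton_field H (w s)) + E_of (w s)))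
    0 1.

Lemma continuous_Rplus (f g : R -> R) (s : R) :
  continuous f s -> continuous g s -> continuous (fun s => f s + g s) s.
Proof. apply (continuous_plus f g). Qed.

Lemma continuous_Rminus (f g : R -> R) (s : R) :
  continuous f s -> continuous g s -> continuous (fun s => f s - g s) s.
Proof. apply (continuous_minus f g). Qed.

Lemma continuous_Rmult (f g : R -> R) (s : R) :
  continuous f s -> continuous g s -> continuous (fun s => f s * g s) s.
Proof. apply (continuous_mult f g). Qed.

Lemma is_derive_Rmult (f g : R -> R) (s df dg : R) :
  is_derive f s df -> is_derive g s dg ->
  is_derive (fun s => f s * g s) s (df * g s + f s * dg).
Proof.
  intros Hf Hg; apply (is_derive_mult f g s df dg Hf Hg), Rmult_comm.
Qed.

Section Action.
Variables (D : R * R * R -> Prop) (H : R * R * R -> R).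
Hypothesis D_open : open D.
Hypothesis H_smooth : smooth_on D H.

Definition zero_energy_trajectory (mu : R) (w : R -> R * R * R * R) : Prop :=
  (forall s, 0 <= s <= 1 -> in_domain D (w s)) /\
  solves_on_unit (hamilton_field H : R * R * R * R -> R * R * R * R) mu w /\
  lifted H (w 0) + E_of (w 0) = 0.

Lemma zero_energy (mu : R) (w : R -> R * R * R * R) (s : R) :
  zero_energy_trajectory mu w -> 0 <= s <= 1 ->
  E_of (w s) = - lifted H (w s).
Proof.
  intros [Hin [Hsol H0]] Hs.
  assert (He := trajectory_energy D H H_smooth mu w Hin Hsol s Hs).
  lra.
Qed.

Lemma action_integrand_continuous (mu : R) (w : R -> R * R * R * R) (s : R) :
  zero_energy_trajectory mu w -> 0 <= s <= 1 ->
  continuous (fun s => mu *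
    (y_of (w s) * x_of (hamilton_field H (w s)) + E_of (w s))) s.
Proof.
  intros [Hin [Hsol _]] Hs.
  assert (Hw := trajectory_continuous H mu w Hsol s Hs).
  apply continuous_Rmult; [apply continuous_const|].
  apply continuous_Rplus; [apply continuous_Rmult|].
  - apply (continuous_comp w y_of); auto; exact (linear_cont _ _ y_of_linear).
  - apply (trajectory_field_continuous D H D_open H_smooth mu w Hin Hsol x_of);
      auto using x_of_linear.
  - apply (continuous_comp w E_of); auto; exact (linear_cont _ _ E_of_linear).
Qed.

Lemma is_RInt_action (mu : R) (w : R -> R * R * R * R) :
  zero_energy_trajectory mu w ->
  is_RInt (fun s => mu *
    (y_of (w s) * x_of (hamilton_field H (w s)) + E_of (w s))) 0 1
    (action H mu w).
Proof.
  intros Hw; apply (RInt_correct (V := R_CompleteNormedModule)).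
  apply (ex_RInt_continuous (V := R_CompleteNormedModule)).
  intros s Hs; rewrite Rmin_left, Rmax_right in Hs by lra.
  now apply action_integrand_continuous.
Qed.

(* The derivative of the boundary term [y dx + E dt] cancels the first-order
   part of the variation of the integrand, up to the differential of [H + E]
   applied to [w - w0], which vanishes to first order because both trajectories
   have zero energy. *)
Lemma action_increment (mu mu0 : R) (w w0 : R -> R * R * R * R) :
  zero_energy_trajectory mu w -> zero_energy_trajectory mu0 w0 ->
  let b s := y_of (w0 s) * (x_of (w s) - x_of (w0 s)) +
             E_of (w0 s) * (t_of (w s) - t_of (w0 s)) in
  exists g, is_RInt g 0 1 (action H mu w - action H mu0 w0 - (b 1 - b 0)) /\
    forall s, 0 <= s <= 1 ->
      g s =
      - mu0 * (lifted H (w s) - lifted H (w0 s) -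
               dir_derive (lifted H) (w0 s) (minus (w s) (w0 s))) +
      (mu - mu0) * ((y_of (w s) - y_of (w0 s)) * x_of (hamilton_field H (w s)) +
                    (E_of (w s) - E_of (w0 s))) +
      mu0 * (y_of (w s) - y_of (w0 s)) *
        (x_of (hamilton_field H (w s)) - x_of (hamilton_field H (w0 s))).
Proof.
  intros Hw Hw0 b.
  destruct (Hw) as [Hin [Hsol _]]; destruct (Hw0) as [Hin0 [Hsol0 _]].
  (* The derivative of [b]; its last term is [mu - mu0] because the t-component of the field is
     1. *)
  set (db := fun s =>
    mu0 * y_of (hamilton_field H (w0 s)) * (x_of (w s) - x_of (w0 s)) +
    y_of (w0 s) * (mu * x_of (hamilton_field H (w s)) -
                   mu0 * x_of (hamilton_field H (w0 s))) +
    (mu0 * E_of (hamilton_field H (w0 s)) * (t_of (w s) - t_of (w0 s)) +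
     E_of (w0 s) * (mu - mu0))).
  assert (Hb : is_RInt db 0 1 (b 1 - b 0)).
  { apply (is_RInt_derive (V := R_CompleteNormedModule) b db).
    - intros s Hs; rewrite Rmin_left, Rmax_right in Hs by lra.
      assert (Hd := fun l Hl => trajectory_derive H mu w Hsol l s Hl Hs).
      assert (Hd0 := fun l Hl => trajectory_derive H mu0 w0 Hsol0 l s Hl Hs).
      apply (is_derive_plus
        (fun s => y_of (w0 s) * (x_of (w s) - x_of (w0 s)))
        (fun s => E_of (w0 s) * (t_of (w s) - t_of (w0 s)))).
      + apply (is_derive_Rmult (fun s => y_of (w0 s))
          (fun s => x_of (w s) - x_of (w0 s))); [apply (Hd0 y_of), y_of_linear|].
        apply (is_derive_minus (fun s => x_of (w s)) (fun s => x_of (w0 s)));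
          [apply (Hd x_of), x_of_linear | apply (Hd0 x_of), x_of_linear].
      + apply (is_derive_Rmult (fun s => E_of (w0 s))
          (fun s => t_of (w s) - t_of (w0 s))); [apply (Hd0 E_of), E_of_linear|].
        replace (mu - mu0) with
          (minus (mu * t_of (hamilton_field H (w s)))
             (mu0 * t_of (hamilton_field H (w0 s))))
          by (rewrite !t_of_hamilton_field; unfold minus, plus, opp; simpl; ring).
        apply (is_derive_minus (fun s => t_of (w s)) (fun s => t_of (w0 s)));
          [apply (Hd t_of), t_of_linear | apply (Hd0 t_of), t_of_linear].
    - intros s Hs; rewrite Rmin_left, Rmax_right in Hs by lra.
      assert (Hc : forall l : R * R * R * R -> R, is_linear l ->
        continuous (fun s => l (w s)) s).
      { intros l Hl; apply (continuous_comp w l).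
        - exact (trajectory_continuous H mu w Hsol s Hs).
        - exact (linear_cont l _ Hl). }
      assert (Hc0 : forall l : R * R * R * R -> R, is_linear l ->
        continuous (fun s => l (w0 s)) s).
      { intros l Hl; apply (continuous_comp w0 l).
        - exact (trajectory_continuous H mu0 w0 Hsol0 s Hs).
        - exact (linear_cont l _ Hl). }
      assert (HX := fun l Hl => trajectory_field_continuous D H D_open H_smooth
        mu w Hin Hsol l s Hl Hs).
      assert (HX0 := fun l Hl => trajectory_field_continuous D H D_open H_smooth
        mu0 w0 Hin0 Hsol0 l s Hl Hs).
      assert (Hk : forall k : R, continuous (fun _ => k) s)
        by (intros; apply continuous_const).
      exact (continuous_Rplus _ _ s
        (continuous_Rplus _ _ s
          (continuous_Rmult _ _ s
            (continuous_Rmult _ _ s (Hk mu0) (HX0 y_of y_of_linear))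
            (continuous_Rminus _ _ s (Hc x_of x_of_linear) (Hc0 x_of x_of_linear)))
          (continuous_Rmult _ _ s (Hc0 y_of y_of_linear)
            (continuous_Rminus _ _ s
              (continuous_Rmult _ _ s (Hk mu) (HX x_of x_of_linear))
              (continuous_Rmult _ _ s (Hk mu0) (HX0 x_of x_of_linear)))))
        (continuous_Rplus _ _ s
          (continuous_Rmult _ _ s
            (continuous_Rmult _ _ s (Hk mu0) (HX0 E_of E_of_linear))
            (continuous_Rminus _ _ s (Hc t_of t_of_linear) (Hc0 t_of t_of_linear)))
          (continuous_Rmult _ _ s (Hc0 E_of E_of_linear) (Hk (mu - mu0))))). }
  eexists; split.
  - apply (is_RInt_minus (V := R_NormedModule)); [|exact Hb].
    apply (is_RInt_minus (V := R_NormedModule)); apply is_RInt_action; auto.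
  - intros s Hs; unfold db.
    rewrite (dir_derive_lifted_field D H H_smooth _ _ (Hin0 s Hs)).
    rewrite (linear_minus x_of _ _ x_of_linear).
    rewrite (linear_minus y_of _ _ y_of_linear).
    rewrite (linear_minus t_of _ _ t_of_linear).
    (* The increment of E becomes minus that of [lifted H], and with the differential from
       [dir_derive_lifted_field] it forms a Taylor remainder. *)
    rewrite (zero_energy mu w s Hw Hs), (zero_energy mu0 w0 s Hw0 Hs).
    unfold minus, plus, opp; simpl; ring.
Qed.

Section Variation.
Context {P : NormedModule R_AbsRing}.
Variables (w : P -> R -> R * R * R * R) (mu : P -> R) (p : P).
Variables (l0 : P -> R * R * R * R) (m0 : P -> R).
Hypothesis Hw : locally p (fun q => zero_energy_trajectory (mu q) (w q)).
Hypothesis Hinit : filterdiff (fun q => w q 0) (locally p) l0.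
Hypothesis Hmu : filterdiff mu (locally p) m0.

Lemma variation_near : exists d, 0 < d /\ forall q, norm (minus q p) < d ->
  zero_energy_trajectory (mu q) (w q).
Proof. now apply locally_norm_iff in Hw. Qed.

Lemma variation_center : zero_energy_trajectory (mu p) (w p).
Proof.
  destruct variation_near as [d [Hd Hq]]; apply Hq.
  now rewrite norm_minus_self.
Qed.

Lemma variation_solves : locally p (fun q => solves_on_unit
  (hamilton_field H : R * R * R * R -> R * R * R * R) (mu q) (w q)).
Proof.
  revert Hw; apply filter_imp; intros q [_ [Hsol _]]; exact Hsol.
Qed.

(** In [action_increment] one term is a Taylor remainder along [w p] and the other two are products
    of increments, so [flow_lipschitz] gives o(|q - p|). *)
Lemma action_variation (e : R) : 0 < e -> exists d, 0 < d /\
  forall q, norm (minus q p) < d ->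
    let b s := y_of (w p s) * (x_of (w q s) - x_of (w p s)) +
               E_of (w p s) * (t_of (w q s) - t_of (w p s)) in
    Rabs (action H (mu q) (w q) - action H (mu p) (w p) - (b 1 - b 0)) <=
      e * norm (minus q p).
Proof.
  intros He.
  destruct (variation_center) as [Hin [Hsol _]].
  destruct (hamilton_field_C1_along D H D_open H_smooth (mu p) (w p) Hin Hsol)
    as [A [M HX]].
  destruct (lifted_C1_along D H D_open H_smooth (mu p) (w p) Hin Hsol)
    as [M' [_ Hlift]].
  assert (HM := C1_along_bound_nonneg _ _ _ _ HX).
  destruct (C1_along_lipschitz _ _ _ _ HX) as [r [Hr HL]].
  destruct (flow_lipschitz _ w mu p A M l0 m0 HX variation_solves Hinit Hmu)
    as [C [d1 [HC [Hd1 Hlip]]]].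
  destruct (filterdiff_lipschitz _ _ _ Hmu) as [C3 [d2 [HC3 [Hd2 H3]]]].
  destruct variation_near as [d3 [Hd3 Hnear]].
  assert (Hmup := Rabs_pos (mu p)).
  set (K := Rabs (mu p) + 1).
  assert (HK : 0 < K) by (unfold K; lra).
  assert (He1 : 0 < e / (2 * K * C)).
  { apply Rdiv_lt_0_compat; auto; repeat apply Rmult_lt_0_compat; lra. }
  destruct (Hlift _ He1) as [d4 [Hd4 H4]].
  (* Coefficient of [N * n] in the two product terms, [T2] and [T3], where [N] is the deviation of
     the trajectory and [n] that of the parameter. *)
  set (L := C3 * (2 * M + 2) + K * ((M + 1) * C)).
  assert (HLpos : 0 < L).
  { unfold L; assert (0 < C3 * (2 * M + 2)) by (apply Rmult_lt_0_compat; lra).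
    assert (0 < K * ((M + 1) * C))
      by (repeat apply Rmult_lt_0_compat; lra); lra. }
  assert (He2 : 0 < e / (2 * C * L)).
  { apply Rdiv_lt_0_compat; auto; repeat apply Rmult_lt_0_compat; lra. }
  exists (Rmin (Rmin d1 (Rmin d2 d3))
    (Rmin (Rmin (d4 / C) (Rmin (r / C) (1 / C))) (e / (2 * C * L)))).
  split.
  { repeat apply Rmin_glb_lt; auto; apply Rdiv_lt_0_compat; lra. }
  intros q Hq b.
  apply Rmin_Rgt_l in Hq; destruct Hq as [Hq Hq'].
  apply Rmin_Rgt_l in Hq; destruct Hq as [Hq1 Hq].
  apply Rmin_Rgt_l in Hq; destruct Hq as [Hq2 Hq3].
  apply Rmin_Rgt_l in Hq'; destruct Hq' as [Hq HqL].
  apply Rmin_Rgt_l in Hq; destruct Hq as [Hq4 Hq].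
  apply Rmin_Rgt_l in Hq; destruct Hq as [Hqr Hqone].
  specialize (H3 q Hq2).
  change (Rabs (mu q - mu p) <= C3 * norm (minus q p)) in H3.
  destruct (action_increment (mu q) (mu p) (w q) (w p) (Hnear q Hq3)
    variation_center) as [g [Hg Hgs]].
  set (n := norm (minus q p)) in *.
  assert (Hn : 0 <= n) by apply norm_ge_0.
  assert (HCr : forall x, n < x / C -> C * n < x).
  { intros x Hx; replace x with (C * (x / C)) by (field; lra).
    now apply Rmult_lt_compat_l. }
  replace (e * n) with ((1 - 0) * (e * n)) by ring.
  apply (norm_RInt_le_const (V := R_NormedModule) g 0 1); [lra| |exact Hg].
  intros s Hs; rewrite (Hgs s Hs).
  specialize (Hlip q s Hq1 Hs).
  change (norm (minus (w q s) (w p s)) <= C * n) in Hlip.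
  assert (HL' := HL s (w q s) Hs (Rle_lt_trans _ _ _ Hlip (HCr _ Hqr))).
  assert (H4' := H4 s (w q s) Hs (Rle_lt_trans _ _ _ Hlip (HCr _ Hq4))).
  assert (Hone : norm (minus (w q s) (w p s)) <= 1).
  { assert (Ho := HCr _ Hqone); exact (Rle_trans _ _ _ Hlip (Rlt_le _ _ Ho)). }
  set (N := norm (minus (w q s) (w p s))) in *.
  assert (HN : 0 <= N) by apply norm_ge_0.
  set (Xq := hamilton_field H (w q s) : R * R * R * R) in *.
  set (Xp := hamilton_field H (w p s) : R * R * R * R) in *.
  assert (Hdy : Rabs (y_of (w q s) - y_of (w p s)) <= N).
  { assert (Hy := y_of_norm (minus (w q s) (w p s))).
    rewrite (linear_minus y_of _ _ y_of_linear) in Hy; exact Hy. }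
  assert (HdE : Rabs (E_of (w q s) - E_of (w p s)) <= N).
  { assert (Hy := E_of_norm (minus (w q s) (w p s))).
    rewrite (linear_minus E_of _ _ E_of_linear) in Hy; exact Hy. }
  assert (HdX : Rabs (x_of Xq - x_of Xp) <= (M + 1) * N).
  { assert (Hx := x_of_norm (minus Xq Xp)).
    rewrite (linear_minus x_of _ _ x_of_linear) in Hx.
    exact (Rle_trans _ _ _ Hx HL'). }
  (* [M] on the reference trajectory plus [(M + 1) * N]; the radius [1 / C] was imposed to have
     [N <= 1] here. *)
  assert (HXq : Rabs (x_of Xq) <= 2 * M + 1).
  { assert (HXp : Rabs (x_of Xp) <= M).
    { destruct (proj1 HX s Hs) as [_ [HXs _]].
      exact (Rle_trans _ _ _ (x_of_norm Xp) HXs). }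
    replace (x_of Xq) with (x_of Xq - x_of Xp + x_of Xp) by ring.
    eapply Rle_trans; [apply Rabs_triang|]; nra. }
  change (Rabs (lifted H (w q s) - lifted H (w p s) -
    dir_derive (lifted H) (w p s) (minus (w q s) (w p s))) <=
    e / (2 * K * C) * N) in H4'.
  set (T := lifted H (w q s) - lifted H (w p s) -
    dir_derive (lifted H) (w p s) (minus (w q s) (w p s))) in *.
  assert (T1 : Rabs (- mu p * T) <= e / 2 * n).
  { rewrite Rabs_mult, Rabs_Ropp.
    apply Rle_trans with (K * (e / (2 * K * C) * (C * n))).
    - apply Rmult_le_compat; auto using Rabs_pos; [unfold K; lra|].
      eapply Rle_trans; [exact H4'|]; apply Rmult_le_compat_l; auto; lra.
    - right; field; lra. }
  assert (T2 : Rabs ((mu q - mu p) *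
    ((y_of (w q s) - y_of (w p s)) * x_of Xq + (E_of (w q s) - E_of (w p s))))
    <= (C3 * n) * (N * (2 * M + 2))).
  { rewrite Rabs_mult; apply Rmult_le_compat; auto using Rabs_pos.
    eapply Rle_trans; [apply Rabs_triang|]; rewrite Rabs_mult.
    assert (Rabs (y_of (w q s) - y_of (w p s)) * Rabs (x_of Xq) <=
      N * (2 * M + 1)) by (apply Rmult_le_compat; auto using Rabs_pos).
    lra. }
  assert (T3 : Rabs (mu p * (y_of (w q s) - y_of (w p s)) * (x_of Xq - x_of Xp))
    <= K * N * ((M + 1) * (C * n))).
  { rewrite !Rabs_mult; apply Rmult_le_compat; auto using Rabs_pos.
    - apply Rmult_le_pos; apply Rabs_pos.
    - apply Rmult_le_compat; auto using Rabs_pos; unfold K; lra.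
    - eapply Rle_trans; [exact HdX|]; apply Rmult_le_compat_l; lra. }
  assert (T4 : (C3 * n) * (N * (2 * M + 2)) + K * N * ((M + 1) * (C * n)) <=
    e / 2 * n).
  { replace (C3 * n * (N * (2 * M + 2)) + K * N * ((M + 1) * (C * n)))
      with (L * N * n) by (unfold L; ring).
    apply Rmult_le_compat_r; auto.
    apply Rle_trans with (L * (C * (e / (2 * C * L)))).
    - apply Rmult_le_compat_l; [lra|]; eapply Rle_trans; [exact Hlip|].
      apply Rmult_le_compat_l; lra.
    - right; field; lra. }
  eapply Rle_trans; [apply Rabs_triang|].
  eapply Rle_trans; [apply Rplus_le_compat_r, Rabs_triang|].
  lra.
Qed.

End Variation.
End Action.

(** * Uniqueness, the shift by one period, and the generating function *)

Lemma zero_energy_trajectory_unique (D : R * R * R -> Prop) (H : R * R * R -> R)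
    (mu : R) (w w0 : R -> R * R * R * R) :
  open D -> smooth_on D H ->
  zero_energy_trajectory D H mu w -> zero_energy_trajectory D H mu w0 ->
  w 0 = w0 0 -> forall s, 0 <= s <= 1 -> w s = w0 s.
Proof.
  intros D_open H_smooth [_ [Hsol _]] [Hin0 [Hsol0 _]] Heq s Hs.
  destruct (hamilton_field_C1_along D H D_open H_smooth mu w0 Hin0 Hsol0)
    as [A [M HX]].
  destruct (ode_stability _ _ _ _ mu HX Hsol0) as [C [d [HC [Hd Hst]]]].
  assert (Hn : norm (minus (w s) (w0 s)) <= C * 0).
  { apply (Hst w mu 0 Hsol); auto; [lra| |].
    - rewrite Heq, norm_minus_self; lra.
    - rewrite Rminus_diag, Rabs_R0; lra. }
  symmetry; apply (ball_norm_eq (w0 s) (w s)); intros eps.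
  unfold ball_norm; eapply Rle_lt_trans; [exact Hn|].
  rewrite Rmult_0_r; apply cond_pos.
Qed.

Definition time_shift (z : R * R * R * R) : R * R * R * R :=
  plus z ((0, 2 * PI, 0, 0) : R * R * R * R).

Lemma time_shift_eq (x t y E : R) :
  time_shift (x, t, y, E) = (x, t + 2 * PI, y, E).
Proof.
  repeat apply injective_projections; simpl; unfold plus; simpl; ring.
Qed.

(** Periodicity of [H] is known on [D] only, while derivatives compare functions near a point;
    openness of [D] provides the neighbourhood on each coordinate line. *)
Lemma hamilton_field_time_shift (D : R * R * R -> Prop) (H : R * R * R -> R)
    (z : R * R * R * R) :
  open D ->
  (forall x y t, D (x, y, t) -> H (x, y, t + 2 * PI) = H (x, y, t)) ->
  D (config_of z) -> hamilton_field H (time_shift z) = hamilton_field H z.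
Proof.
  intros D_open H_periodic Hz; destruct z as [[[x t] y] E].
  rewrite time_shift_eq; unfold config_of in Hz; simpl in Hz.
  destruct (D_open _ Hz) as [eps Heps].
  assert (Hx : locally x (fun s => D (s, y, t))).
  { exists eps; intros s Hs; apply Heps; split; [split|];
      auto using ball_center. }
  assert (Hy : locally y (fun s => D (x, s, t))).
  { exists eps; intros s Hs; apply Heps; split; [split|];
      auto using ball_center. }
  assert (Ht : locally t (fun s => D (x, y, s))).
  { exists eps; intros s Hs; apply Heps; split; [split|];
      auto using ball_center. }
  assert (Ey : Derive (fun s => H (x, s, t + 2 * PI)) y =
    Derive (fun s => H (x, s, t)) y).
  { apply Derive_ext_loc; revert Hy; apply filter_imp; auto. }
  assert (Ex : Derive (fun s => H (s, y, t + 2 * PI)) x =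
    Derive (fun s => H (s, y, t)) x).
  { apply Derive_ext_loc; revert Hx; apply filter_imp; auto. }
  assert (Et : Derive (fun s => H (x, y, s)) (t + 2 * PI) =
    Derive (fun s => H (x, y, s)) t).
  { transitivity (Derive (fun s => H (x, y, s + 2 * PI)) t).
    - rewrite <- (Derive_shift (fun s => H (x, y, s))).
      rewrite <- (Derive_shift (fun s => H (x, y, s + 2 * PI))).
      apply Derive_ext; intros s; do 2 f_equal; ring.
    - apply Derive_ext_loc; revert Ht; apply filter_imp; auto. }
  exact (f_equal2 pair (f_equal2 pair (f_equal2 pair Ey eq_refl)
    (f_equal Ropp Ex)) (f_equal Ropp Et)).
Qed.

Lemma zero_energy_trajectory_time_shift (D : R * R * R -> Prop)
    (H : R * R * R -> R) (mu : R) (w : R -> R * R * R * R) :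
  open D ->
  (forall x y t, D (x, y, t + 2 * PI) <-> D (x, y, t)) ->
  (forall x y t, D (x, y, t) -> H (x, y, t + 2 * PI) = H (x, y, t)) ->
  zero_energy_trajectory D H mu w ->
  zero_energy_trajectory D H mu (fun s => time_shift (w s)).
Proof.
  intros D_open D_shift H_periodic [Hin [Hsol H0]].
  assert (Hc : forall z, config_of (time_shift z) =
    (x_of z, y_of z, t_of z + 2 * PI)).
  { intros [[[x t] y] E]; now rewrite time_shift_eq. }
  split; [|split].
  - intros s Hs; unfold in_domain; rewrite Hc; apply D_shift, Hin, Hs.
  - intros s Hs; rewrite (hamilton_field_time_shift D); auto;
      [|now apply Hin].
    exact (is_derive_plus_const w _ s _ (Hsol s Hs)).
  - unfold lifted; rewrite Hc, H_periodic; [|apply (Hin 0); lra].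
    etransitivity; [|exact H0]; unfold lifted, config_of; f_equal.
    destruct (w 0) as [[[x t] y] E]; now rewrite time_shift_eq.
Qed.

Lemma action_time_shift (D : R * R * R -> Prop) (H : R * R * R -> R)
    (mu : R) (w : R -> R * R * R * R) :
  open D ->
  (forall x y t, D (x, y, t) -> H (x, y, t + 2 * PI) = H (x, y, t)) ->
  (forall s, 0 <= s <= 1 -> D (config_of (w s))) ->
  action H mu (fun s => time_shift (w s)) = action H mu w.
Proof.
  intros D_open H_periodic Hin; apply RInt_ext; intros s Hs.
  rewrite Rmin_left, Rmax_right in Hs by lra.
  rewrite (hamilton_field_time_shift D); auto; [|apply Hin; lra].
  destruct (w s) as [[[x t] y] E]; now rewrite time_shift_eq.
Qed.

Theorem proposition1
  (D : R * R * R -> Prop) (H : R * R * R -> R)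
  (U : R * R -> Prop) (y ttau : R * R -> R)
  (phi : R -> phase -> phase)
  (D_open : open D)
  (D_shift : forall x y0 t, D (x, y0, t + 2 * PI) <-> D (x, y0, t))
  (H_smooth : smooth_on D H)
  (H_periodic : forall x y0 t,
     D (x, y0, t) -> H (x, y0, t + 2 * PI) = H (x, y0, t))
  (U_open : open U)
  (U_shift : forall t E, U (t + 2 * PI, E) <-> U (t, E))
  (y_smooth : smooth_on U y)
  (y_periodic : forall t E, U (t, E) -> y (t + 2 * PI, E) = y (t, E))
  (y_section : forall t E, U (t, E) ->
     D (0, y (t, E), t) /\ extended_hamiltonian H (0, t, y (t, E), E) = 0)
  (ttau_smooth : smooth_on U ttau)
  (ttau_periodic : forall t E, U (t, E) -> ttau (t + 2 * PI, E) = ttau (t, E))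
  (ttau_pos : forall p, U p -> 0 < ttau p)
  (phi_solution : forall p, U p ->
     solves_hamilton D H (section_point y p) (ttau p)
       (fun tau => phi tau (section_point y p)))
  (impact : forall p, U p -> x_of (phi (ttau p) (section_point y p)) = 0) :
  (forall t0 E0, U (t0, E0) ->
     let z0 := section_point y (t0, E0) in
     let z1 := phi (ttau (t0, E0)) z0 in
     let t1 := fst (impact_map phi y ttau (t0, E0)) in
     let E1 := snd (impact_map phi y ttau (t0, E0)) in
     (forall tau, 0 <= tau <= ttau (t0, E0) -> t_of (phi tau z0) = t0 + tau) /\
     E1 = - H (0, y_of z1, t0 + ttau (t0, E0)) /\
     z1 = (0, t1, y_of z1, E1) /\
     section H z0 /\ section H z1) /\
  exact_symplectic E_dt U (impact_map phi y ttau).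
Proof.
  set (w := fun q s => phi (s * ttau q) (section_point y q) : R * R * R * R).
  assert (Hw0 : forall q, U q -> w q 0 = section_point y q).
  { intros q Hq; unfold w; rewrite Rmult_0_l; apply (phi_solution q Hq). }
  assert (Hw1 : forall q, w q 1 = phi (ttau q) (section_point y q)).
  { intros q; unfold w; now rewrite Rmult_1_l. }
  assert (Htraj : forall q, U q -> zero_energy_trajectory D H (ttau q) (w q)).
  { intros q Hq; destruct (phi_solution q Hq) as [_ Hsol].
    assert (HT := ttau_pos q Hq).
    assert (Htau : forall s, 0 <= s <= 1 -> 0 <= s * ttau q <= ttau q)
      by (intros; nra).
    split; [|split].
    - intros s Hs; exact (proj1 (Hsol _ (Htau s Hs))).
    - intros s Hs.
      apply (is_derive_comp
        ((fun tau => phi tau (section_point y q)) : R -> R * R * R * R)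
        (fun s => s * ttau q)).
      + exact (proj2 (Hsol _ (Htau s Hs))).
      + auto_derive; auto; ring.
    - rewrite Hw0 by auto; destruct q as [t E].
      exact (proj2 (y_section t E Hq)). }
  assert (Htime : forall q tau, U q -> 0 <= tau <= ttau q ->
    t_of (phi tau (section_point y q)) = fst q + tau).
  { intros q tau Hq Htau; assert (HT := ttau_pos q Hq).
    assert (Hs : 0 <= tau / ttau q <= 1).
    { split; [apply Rdiv_le_0_compat; lra|].
      apply (Rmult_le_reg_r (ttau q)); auto.
      unfold Rdiv; rewrite Rmult_assoc, Rinv_l by lra; lra. }
    assert (Ht := trajectory_time H (ttau q) (w q)
      (proj1 (proj2 (Htraj q Hq))) _ Hs).
    rewrite Hw0 in Ht by auto; unfold w in Ht.
    replace (tau / ttau q * ttau q) with tau in Ht by (field; lra).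
    exact Ht. }
  assert (Hend : forall q, U q -> t_of (w q 1) = fst q + ttau q).
  { intros q Hq; rewrite Hw1; apply Htime; auto.
    assert (HT := ttau_pos q Hq); lra. }
  assert (Henergy : forall q, U q -> E_of (w q 1) = - lifted H (w q 1)).
  { intros q Hq; apply (zero_energy D H H_smooth (ttau q)); auto; lra. }
  assert (Hx1 : forall q, U q -> x_of (w q 1) = 0).
  { intros q Hq; rewrite Hw1; now apply impact. }
  split.
  { intros t0 E0 Hq z0 z1 t1 E1.
    assert (Hz1 : w (t0, E0) 1 = z1) by apply Hw1.
    assert (Ht1 := Hend _ Hq); assert (HE1 := Henergy _ Hq).
    assert (Hx := Hx1 _ Hq); rewrite Hz1 in Ht1, HE1, Hx; simpl in Ht1.
    assert (HE1' : E_of z1 = - H (0, y_of z1, t0 + ttau (t0, E0))).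
    { rewrite HE1; unfold lifted, config_of; now rewrite Hx, Ht1. }
    split; [intros tau Htau; now apply (Htime (t0, E0))|].
    split; [exact HE1'|].
    split.
    { change (z1 = (0, t0 + ttau (t0, E0), y_of z1, E_of z1)).
      rewrite <- Ht1 at 1; rewrite <- Hx at 1.
      now destruct z1 as [[[x t] y'] E]. }
    split; [split; [reflexivity | apply (y_section t0 E0 Hq)]|].
    split; [exact Hx|].
    destruct z1 as [[[x t] y'] E]; unfold extended_hamiltonian.
    simpl in HE1, Hx, Ht1; rewrite HE1; unfold lifted, config_of; simpl; ring. }
  exists (fun q => action H (ttau q) (w q)); split.
  { intros t E Hq; assert (Hq' : U (t + 2 * PI, E)) by now apply U_shift.
    rewrite ttau_periodic by auto.
    (* Equivariance of [phi] under the shift is not assumed; both sides are zero-energy trajectories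
       with the same speed and the same initial point. *)
    assert (Heq : forall s, 0 <= s <= 1 ->
      w (t + 2 * PI, E) s = time_shift (w (t, E) s)).
    { apply (zero_energy_trajectory_unique D H (ttau (t, E))); auto.
      - rewrite <- ttau_periodic by auto; now apply Htraj.
      - apply zero_energy_trajectory_time_shift; auto.
      - rewrite !Hw0 by auto; unfold section_point; simpl.
        now rewrite time_shift_eq, y_periodic. }
    rewrite <- (action_time_shift D H (ttau (t, E)) (w (t, E))); auto.
    - apply RInt_ext; intros s Hs.
      rewrite Rmin_left, Rmax_right in Hs by lra.
      rewrite Heq by lra; reflexivity.
    - apply (Htraj _ Hq). }
  intros p Hp.
  assert (Hnear : locally p U) by now apply U_open.
  assert (Hmu : filterdiff ttau (locally p) (dir_derive ttau p)).
  { exact (filterdiff_dir_derive ttau p (proj1 (ttau_smooth 1%nat) p Hp)). }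
  assert (Hy : filterdiff y (locally p) (dir_derive y p)).
  { exact (filterdiff_dir_derive y p (proj1 (y_smooth 1%nat) p Hp)). }
  set (l0 := fun v : R * R => (zero : R, fst v, dir_derive y p v, snd v)).
  assert (Hinit : filterdiff (fun q => w q 0) (locally p) l0).
  { apply (filterdiff_ext_locally (section_point y)).
    - revert Hnear; apply filter_imp; intros q Hq; symmetry; now apply Hw0.
    - assert (Ht : filterdiff (fun q : R * R => fst q) (locally p)
        (fun v => fst v)) by (apply filterdiff_linear, is_linear_fst).
      assert (HE : filterdiff (fun q : R * R => snd q) (locally p)
        (fun v => snd v)) by (apply filterdiff_linear, is_linear_snd).
      assert (H0 : filterdiff (fun _ : R * R => 0) (locally p) (fun _ => zero))
        by exact (filterdiff_const (0 : R)).
      exact (filterdiff_pair _ _ p _ _ (filterdiff_pair _ _ p _ _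
        (filterdiff_pair _ _ p _ _ H0 Ht) Hy) HE). }
  assert (Hfam : locally p (fun q => zero_energy_trajectory D H (ttau q) (w q))).
  { revert Hnear; apply filter_imp; exact Htraj. }
  destruct (variation_center D H w ttau p Hfam) as [Hin [Hsol _]].
  destruct (hamilton_field_C1_along D H D_open H_smooth (ttau p) (w p) Hin Hsol)
    as [A [M HX]].
  (* The increments of the flow at [s = 1], read in the energy component, satisfy the criterion of
     asymptotic linearity. *)
  assert (HE : ex_filterdiff (fun q => E_of (w q 1)) (locally p)).
  { apply asymptotically_linear_differentiable; intros e He.
    destruct (flow_increments _ w ttau p A M l0 (dir_derive ttau p) HX
      (variation_solves D H w ttau p Hfam) Hinit Hmu e He) as [d [Hd Hinc]].
    exists d; split; auto; intros q q1 q2 a b Hq Hq1 Hq2 Hrel.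
    assert (H1 := Hinc q q1 q2 a b 1 ltac:(lra) Hq Hq1 Hq2 Hrel).
    match type of H1 with norm ?x <= _ =>
      assert (H2 := Rle_trans _ _ _ (E_of_norm x) H1) end.
    rewrite (linear_minus E_of _ _ E_of_linear) in H2.
    rewrite (linear_plus E_of E_of_linear) in H2.
    rewrite !(linear_scal E_of E_of_linear) in H2.
    rewrite !(linear_minus E_of _ _ E_of_linear) in H2.
    exact H2. }
  destruct HE as [dE HdE].
  set (dt := fun v : R * R => plus (fst v) (dir_derive ttau p v)).
  assert (Hdt : filterdiff (fun q => fst q + ttau q) (locally p) dt).
  { apply (filterdiff_plus_fct (fun q : R * R => fst q) ttau); auto.
    apply filterdiff_linear, is_linear_fst. }
  set (E1 := E_of (w p 1)).
  (* The boundary term with E1 and E0 frozen at [p]: its differential there is E1 dt1 - E0 dt0. The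
     action differs from it by o(|q - p|) up to a constant, so it has the same differential at
     [p]. *)
  set (G := fun q : R * R =>
    minus (scal E1 (fst q + ttau q)) (scal (snd p) (fst q)) : R).
  set (dS := fun v : R * R => minus (scal E1 (dt v)) (scal (snd p) (fst v)) : R).
  assert (HG : filterdiff G (locally p) dS).
  { apply (filterdiff_minus_fct (fun q : R * R => scal E1 (fst q + ttau q))
      (fun q => scal (snd p) (fst q))).
    - apply (filterdiff_scal_r_fct E1 (fun q : R * R => fst q + ttau q));
        [apply Rmult_comm | exact Hdt].
    - apply (filterdiff_scal_r_fct (snd p) (fun q : R * R => fst q));
        [apply Rmult_comm | apply filterdiff_linear, is_linear_fst]. }
  exists (fun v => (dt v, dE v)), dS.
  split; [|split].
  - apply (filterdiff_pair (fun q : R * R => fst q + ttau q)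
      (fun q => E_of (phi (ttau q) (section_point y q)))); auto.
    apply (filterdiff_ext (fun q => E_of (w q 1))); auto.
    intros q; now rewrite Hw1.
  - destruct (proj1 (filterdiff_norm_iff G p dS) HG) as [HdS HGe].
    apply (proj2 (filterdiff_norm_iff
      (fun q => action H (ttau q) (w q)) p dS)); split; auto.
    intros e He.
    destruct (action_variation D H D_open H_smooth w ttau p l0
      (dir_derive ttau p) Hfam Hinit Hmu (e / 2) ltac:(lra)) as [d1 [Hd1 H1]].
    destruct (HGe (e / 2) ltac:(lra)) as [d2 [Hd2 H2]].
    destruct (proj1 (locally_norm_iff U p) Hnear) as [d3 [Hd3 H3]].
    exists (Rmin d1 (Rmin d2 d3)); split; [repeat apply Rmin_glb_lt; auto|].
    intros q Hq; apply Rmin_Rgt_l in Hq; destruct Hq as [Hq1 Hq].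
    apply Rmin_Rgt_l in Hq; destruct Hq as [Hq2 Hq3].
    specialize (H1 q Hq1); specialize (H2 q Hq2); specialize (H3 q Hq3).
    cbv beta zeta in H1.
    rewrite !Hend, !Hx1, !Hw0 in H1 by auto; fold E1 in H1.
    change (Rabs (G q - G p - dS (minus q p)) <= e / 2 * norm (minus q p)) in H2.
    change (Rabs (action H (ttau q) (w q) - action H (ttau p) (w p) -
      dS (minus q p)) <= e * norm (minus q p)).
    replace (action H (ttau q) (w q) - action H (ttau p) (w p) -
      dS (minus q p)) with
      ((action H (ttau q) (w q) - action H (ttau p) (w p) - (G q - G p)) +
       (G q - G p - dS (minus q p))) by ring.
    eapply Rle_trans; [apply Rabs_triang|].
    replace (e * norm (minus q p)) with
      (e / 2 * norm (minus q p) + e / 2 * norm (minus q p)) by field.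
    apply Rplus_le_compat; [|exact H2].
    (* With x = 0 at both ends, [b 1 - b 0] is exactly [G q - G p]. *)
    eapply Rle_trans; [|exact H1]; right; f_equal.
    unfold G, minus, plus, opp, scal, section_point; simpl; unfold mult; simpl.
    ring.
  - intros v; unfold E_dt, impact_map; simpl; rewrite <- Hw1.
    fold E1.
    unfold dS, minus, plus, opp, scal; simpl; unfold mult; simpl; ring.
Qed.
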